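(* With the notation of the context, the following hold. (1) $(\mathcal H_{\mathrm{int}},\bullet,\Delta_{\spadesuit},u,\varepsilon)$ is a bialgebra. (2) $(\mathcal H_{\mathrm{int}},\spadesuit,\Delta_{\bullet},u,\varepsilon)$ is a connected filtered Hopf algebra, both with respect to the filtration coming from the grading $\mathcal H_{\mathrm{int}}=\bigoplus_{n\in\mathbb N}\mathbb Q[\mathbf{StIP}_n]$ by size and with respect to the filtration coming from the grading $\mathcal H_{\mathrm{int}}=\bigoplus_{\ell\in\mathbb N}\mathbb Q[\mathbf{NB}_\ell]$ by number of blocks.
   Context: $\mathbb N=\{0,1,2,\dots\}$, $\mathbb N_{\ge1}=\{1,2,\dots\}$, $[n]=\{1,\dots,n\}$, $[0]=\emptyset$. For a finite set $A\subset\mathbb N_{\ge1}$, an interval partition of $A$ is a finite set $\mathcal I$ of non-empty pairwise disjoint sets (blocks) with union $A$, each block being an interval of $\mathbb N_{\ge1}$ (a set of consecutive integers $\{a,a+1,\dots,b\}$). $\mathbf{IP}(A)$ is the set of these ($\mathbf{IP}(\emptyset)=\{\emptyset\}$), $\mathbf{IP}=\bigcup_A\mathbf{IP}(A)$, and $\bigcup\mathcal I$ denotes the ground set of $\mathcal I$. $\mathbf{StIP}_n:=\mathbf{IP}([n])$, $\mathbf{StIP}:=\bigcup_{n}\mathbf{StIP}_n$ (standardized interval partitions), and $\mathbf{NB}_\ell\subset\mathbf{StIP}$ is the set of those with exactly $\ell$ blocks. $e:=\emptyset\in\mathbf{StIP}_0$. Standardization: for $\mathcal I\in\mathbf{IP}$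 with $|\bigcup\mathcal I|=n$, $\mathbf{std}(\mathcal I)\in\mathbf{StIP}_n$ is the image of $\mathcal I$, block by block, under the unique order-preserving bijection $\bigcup\mathcal I\to[n]$. Gluing: for $\mathcal I,\mathcal J\in\mathbf{IP}$, let $\sim$ be the smallest equivalence relation on the set of blocks $\mathcal I\cup\mathcal J$ such that $E\sim F$ whenever $E\cap F\neq\emptyset$. Then $\mathcal I\cdot_{\mathrm{glue}}\mathcal J:=\{\bigcup_{X\in[T]_\sim}X\mid T\in\mathcal I\cup\mathcal J\}$, an interval partition of $\bigcup\mathcal I\cup\bigcup\mathcal J$. $\mathcal H_{\mathrm{int}}$ is the free $\mathbb Q$-vector space on $\mathbf{StIP}$. Operations, given on basis elements and extended linearly: - for $\mathfrak s=\{\mathfrak s_1,\dots,\mathfrak s_m\}$, $\mathfrak t=\{\mathfrak t_1,\dots,\mathfrak t_n\}$ in $\mathbf{StIP}$, $\mathfrak s\bullet\mathfrak t:=\{\mathfrak s_1,\dots,\mathfrak s_m,\mathfrak t_1',\dots,\mathfrak t_n'\}$ with $\mathfrak t_i':=|\bigcup\mathfrak s|+\mathfrak t_i$ (translate); - $\Delta_\bullet(\mathfrak s):=\sum_{\mathfrak a\bullet\mathfrak b=\mathfrak s}\mathfrak a\otimes\mathfrak b$ (sum over $\mathfrak a,\mathfrak b\in\mathbf{StIP}$), the dual of $\bullet$; - $\Delta_\spadesuit(\mathfrak s):=\sum_{A\cup A'=\bigcup\mathfrak s}\ \sum_{\mathcal I\in\mathbf{IP}(A),\,\mathcal I'\in\mathbf{IP}(A'),\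 \mathcal I\cdot_{\mathrm{glue}}\mathcal I'=\mathfrak s}\mathbf{std}(\mathcal I)\otimes\mathbf{std}(\mathcal I')$, the outer sum over ordered pairs of (not necessarily disjoint) subsets; - $\mathfrak s\spadesuit\mathfrak t:=\sum_{\mathfrak g\in\mathbf{StIP}}\langle\mathfrak s\otimes\mathfrak t,\Delta_\spadesuit(\mathfrak g)\rangle\,\mathfrak g$, where $\langle\cdot,\cdot\rangle$ is the pairing making basis elements orthonormal (the dual of $\Delta_\spadesuit$; the sum is finite); - unit $u:\mathbb Q\to\mathcal H_{\mathrm{int}}$, $u(1)=e$; counit $\varepsilon(e)=1$ and $\varepsilon(\mathfrak s)=0$ for $\mathfrak s\in\mathbf{StIP}_n$, $n\ge1$. The filtration coming from a grading $\bigoplus_n V_n$ is $F_n=\bigoplus_{k\le n}V_k$. A bialgebra is filtered by $(F_n)$ if $F_p\cdot F_q\subset F_{p+q}$ and $\Delta(F_n)\subset\sum_{p+q=n}F_p\otimes F_q$, and connected if $F_0$ is one-dimensional. *)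

(* Defs.v *)
From HB Require Import structures.
From mathcomp Require Import all_boot all_order all_algebra.
From mathcomp Require Import finmap zify.
From mathcomp.multinomials Require Import monalg.

Set Implicit Arguments.
Unset Strict Implicit.
Unset Printing Implicit Defensive.

Import GRing.Theory.
Local Open Scope fset_scope.
Local Open Scope ring_scope.

(* The tensor product of the free modules on K1 and K2 is realized as the     *)
(* free module {malg R[K1 * K2]}, with (k1, k2) standing for k1 (x) k2.       *)

Section FreeModules.
Variable R : fieldType.

Definition lin_ext (K : choiceType) (V : lmodType R) (f : K -> V)
    (x : {malg R[K]}) : V := \sum_(k <- msupp x) x@_k *: f k.

Definition bilin_ext (K L : choiceType) (V : lmodType R) (f : K -> L -> V)
    (x : {malg R[K]}) (y : {malg R[L]}) : V :=
  lin_ext (fun k => lin_ext (f k) y) x.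

Definition tens (K L : choiceType) (x : {malg R[K]}) (y : {malg R[L]}) :
    {malg R[(K * L)%type]} :=
  bilin_ext (fun k l => << (k, l) >>) x y.

(* The linear map on the tensor product induced by a bilinear map. *)
Definition tens_lift (K L : choiceType) (V : lmodType R)
    (f : {malg R[K]} -> {malg R[L]} -> V) : {malg R[(K * L)%type]} -> V :=
  lin_ext (fun kl => f << kl.1 >> << kl.2 >>).

Definition tens_map (K K' L L' : choiceType)
    (f : {malg R[K]} -> {malg R[K']}) (g : {malg R[L]} -> {malg R[L']}) :
    {malg R[(K * L)%type]} -> {malg R[(K' * L')%type]} :=
  tens_lift (fun x y => tens (f x) (g y)).

Definition tens_assoc (K L M : choiceType) :
    {malg R[((K * L) * M)%type]} -> {malg R[(K * (L * M))%type]} :=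
  lin_ext (fun k => << (k.1.1, (k.1.2, k.2)) >>).

(* (a (x) b) (c (x) d) = m a c (x) m b d *)
Definition tens_mul (K : choiceType)
    (m : {malg R[K]} -> {malg R[K]} -> {malg R[K]}) :
    {malg R[(K * K)%type]} -> {malg R[(K * K)%type]} -> {malg R[(K * K)%type]} :=
  bilin_ext (fun k l => tens (m << k.1 >> << l.1 >>) (m << k.2 >> << l.2 >>)).

End FreeModules.

Section Bialgebras.
Variables (R : fieldType) (K : choiceType).
Local Notation H := {malg R[K]}.
Local Notation HH := {malg R[(K * K)%type]}.

Record is_algebra (m : H -> H -> H) (u : R -> H) : Prop := IsAlgebra {
  alg_linear_l : forall y, linear (m ^~ y);
  alg_linear_r : forall x, linear (m x);
  alg_unit_linear : linear (u : R^o -> H);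
  alg_mulA : associative m;
  alg_mul1x : left_id (u 1) m;
  alg_mulx1 : right_id (u 1) m
}.

Record is_coalgebra (D : H -> HH) (eps : H -> R) : Prop := IsCoalgebra {
  coalg_linear : linear D;
  coalg_counit_linear : scalar eps;
  coalg_coassoc : forall x,
    tens_assoc (tens_map D id (D x)) = tens_map id D (D x);
  coalg_counit_l : forall x, tens_lift (fun a b => eps a *: b) (D x) = x;
  coalg_counit_r : forall x, tens_lift (fun a b => eps b *: a) (D x) = x
}.

Record is_bialgebra (m : H -> H -> H) (D : H -> HH) (u : R -> H)
    (eps : H -> R) : Prop := IsBialgebra {
  bialg_alg : is_algebra m u;
  bialg_coalg : is_coalgebra D eps;
  bialg_comulM : {morph D : x y / m x y >-> tens_mul m x y};
  bialg_comul1 : D (u 1) = tens (u 1) (u 1);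
  bialg_counitM : {morph eps : x y / m x y >-> x * y};
  bialg_counit1 : eps (u 1) = 1
}.

Definition is_antipode (m : H -> H -> H) (D : H -> HH) (u : R -> H)
    (eps : H -> R) (S : H -> H) : Prop :=
  [/\ linear S,
      forall x, tens_lift m (tens_map S id (D x)) = u (eps x)
    & forall x, tens_lift m (tens_map id S (D x)) = u (eps x)].

Definition is_hopf_algebra (m : H -> H -> H) (D : H -> HH) (u : R -> H)
    (eps : H -> R) : Prop :=
  is_bialgebra m D u eps /\ exists S, is_antipode m D u eps S.

(* The submodule R[S] spanned by a set S of basis elements. *)
Definition basis_span (S : pred K) (x : H) : Prop :=
  forall k, k \in msupp x -> S k.

Definition grading_filtration (V : nat -> H -> Prop) (n : nat) (x : H) : Prop :=
  exists2 v : nat -> H, forall k, V k (v k) & x = \sum_(k < n.+1) v k.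

Definition tens_sub (P Q : H -> Prop) (z : HH) : Prop :=
  exists2 s : seq (H * H), forall ab, ab \in s -> P ab.1 /\ Q ab.2
                         & z = \sum_(ab <- s) tens ab.1 ab.2.

Definition is_filtered (m : H -> H -> H) (D : H -> HH) (F : nat -> H -> Prop) :
    Prop :=
  (forall p q x y, F p x -> F q y -> F (p + q)%N (m x y)) /\
  (forall n x, F n x ->
     exists2 z : nat -> HH, forall p, (p <= n)%N -> tens_sub (F p) (F (n - p)%N) (z p)
                          & D x = \sum_(p < n.+1) z p).

Definition one_dimensional (P : H -> Prop) : Prop :=
  exists2 v : H, v != 0 & forall x, P x <-> exists c : R, x = c *: v.

Definition is_connected_filtered_hopf (m : H -> H -> H) (D : H -> HH)
    (u : R -> H) (eps : H -> R) (F : nat -> H -> Prop) : Prop :=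
  [/\ is_hopf_algebra m D u eps, is_filtered m D F & one_dimensional (F 0%N)].

End Bialgebras.

Section IntervalPartitions.
Local Open Scope nat_scope.

Definition ivl (a b : nat) : {fset nat} := [fset x in iota a (b.+1 - a)].

Definition is_interval (E : {fset nat}) : bool :=
  [exists a : E, [exists b : E, (0 < val a) && (E == ivl (val a) (val b))]].

(* Intervals in this sense are nonempty. *)
Definition is_ip (I : {fset {fset nat}}) : bool :=
  [forall E : I, is_interval (val E)] && trivIfset I.

Record IP := MkIP { blocks :> {fset {fset nat}}; _ : is_ip blocks }.
HB.instance Definition _ := [isSub for blocks].
HB.instance Definition _ := [Choice of IP by <:].

Definition ground (I : IP) : {fset nat} := fcover I.

Definition IP_on (A : {fset nat}) : {fset IP} :=
  [fset I in pmap insub (fpowerset (fpowerset A)) | ground I == A].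

Definition is_std (I : IP) : bool := ground I == ivl 1 #|` ground I|.

Record StIP := MkStIP { ip :> IP; _ : is_std ip }.
HB.instance Definition _ := [isSub for ip].
HB.instance Definition _ := [Choice of StIP by <:].

Definition size_st (s : StIP) : nat := #|` ground s|.
Definition nblocks (s : StIP) : nat := #|` blocks s|.

Definition StIP_n (n : nat) : {fset StIP} :=
  [fset s in pmap insub (IP_on (ivl 1 n))].

Definition StIP_le (n : nat) : {fset StIP} := \bigcup_(k <- iota 0 n.+1) StIP_n k.

(* On A, the rank is the order-preserving bijection from A to {1, ..., #|A|}. *)
Definition rank (A : {fset nat}) (x : nat) : nat := #|` [fset y in A | y <= x]|.

Definition std_blocks (I : IP) : {fset {fset nat}} :=
  [fset (rank (ground I) @` (E : {fset nat})) | E in blocks I].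

Definition shift (n : nat) (E : {fset nat}) : {fset nat} := [fset n + x | x in E].

Definition bullet_blocks (s t : StIP) : {fset {fset nat}} :=
  blocks s `|` [fset shift (size_st s) E | E in blocks t].

(* connect is the reflexive transitive closure; as the relation "E meets F"   *)
(* is symmetric, it is the smallest equivalence relation containing it.       *)
Definition glue (I J : IP) : {fset {fset nat}} :=
  let B := blocks I `|` blocks J in
  let meets := [rel E F : B | val E `&` val F != fset0] in
  [fset \big[fsetU/fset0]_(X : B | connect meets X T) val X | T : B].

Lemma in_ivl a b x : (x \in ivl a b) = (a <= x <= b).
Proof. by rewrite !inE /= mem_iota; lia. Qed.

Lemma card_ivl1 n : #|` ivl 1 n| = n.
Proof. by rewrite card_fseq undup_id ?iota_uniq // size_iota subn1. Qed.

Lemma is_intervalP E :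
  reflect (exists a b, 0 < a <= b /\ E = ivl a b) (is_interval E).
Proof.
apply: (iffP idP) => [/existsP[a /existsP[b /andP[a0 /eqP Eab]]]|].
  exists (val a), (val b); split=> //; rewrite a0 /=.
  have /fsetP/(_ (val a)) := Eab.
  by rewrite in_ivl (valP a) => /esym/andP[].
move=> [a [b [/andP[a0 ab] Eab]]].
have aE : a \in E by rewrite Eab in_ivl leqnn.
have bE : b \in E by rewrite Eab in_ivl ab leqnn.
by apply/existsP; exists [` aE]; apply/existsP; exists [` bE]; rewrite a0 /= Eab.
Qed.

Lemma is_ipP (I : {fset {fset nat}}) :
  reflect ((forall E, E \in I -> is_interval E) /\
           {in I &, forall E F, E != F -> [disjoint E & F]%fset}) (is_ip I).
Proof.
apply: (iffP andP) => -[h1 h2]; split.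
- by move=> E EI; have /forallP/(_ [` EI]) := h1.
- exact/trivIfsetP.
- by apply/forallP => E; apply: h1; exact: valP.
- exact/trivIfsetP.
Qed.

Lemma in_fcover (P : {fset {fset nat}}) x :
  reflect (exists2 E, E \in P & x \in E) (x \in fcover P).
Proof.
apply: (iffP (bigfcupP _ _ _ _)) => [[E /andP[EP _] xE]|[E EP xE]]; exists E => //.
by rewrite EP.
Qed.

Lemma mem_IP_on A (I : IP) : (I \in IP_on A) = (ground I == A).
Proof.
rewrite !inE /= mem_pmap_sub fpowersetE; case: eqP => [<-|]; last by rewrite andbF.
rewrite andbT; apply/fsubsetP => E EI; rewrite fpowersetE; apply/fsubsetP => x xE.
by apply/in_fcover; exists E.
Qed.

Lemma is_stdP (I : IP) : reflect (exists n, ground I = ivl 1 n) (is_std I).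
Proof.
apply: (iffP eqP) => [->|[n ->]]; last by rewrite card_ivl1.
by exists #|` ground I|.
Qed.

Lemma mem_StIP_n n (s : StIP) : (s \in StIP_n n) = (size_st s == n).
Proof.
rewrite !inE /= mem_pmap_sub mem_IP_on /size_st.
by rewrite (eqP (valP s)) card_ivl1; apply/eqP/eqP => [/(congr1 (fun A : {fset nat} => #|` A|))|->]; rewrite ?card_ivl1.
Qed.

Lemma mem_StIP_le n (s : StIP) : (s \in StIP_le n) = (size_st s <= n).
Proof.
apply/bigfcupP/idP => [[k]|sn].
  by rewrite andbT mem_iota mem_StIP_n => ? /eqP ->; lia.
exists (size_st s); last by rewrite mem_StIP_n.
by rewrite andbT mem_iota; lia.
Qed.

Lemma rankS A x : x.+1 \in A -> rank A x.+1 = (rank A x).+1.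
Proof.
move=> xA; rewrite /rank; set B := [fset y in A | y <= x].
have -> : [fset y in A | y <= x.+1] = x.+1 |` B.
  by apply/fsetP => y; rewrite !inE /=; case: eqP => [->|]; rewrite ?xA ?leqnn //=;
     case: (y \in A) => //=; lia.
by rewrite cardfsU1 !inE /= ltnn andbF.
Qed.

Lemma rank_lt (A : {fset nat}) x y : y \in A -> x < y -> rank A x < rank A y.
Proof.
move=> yA xy; apply: fproper_ltn_card; rewrite fproperE; apply/andP; split.
  by apply/fsubsetP => z; rewrite !inE /= => /andP[-> /=]; lia.
by apply/fsubsetPn; exists y; rewrite !inE /= yA ?leqnn //= -ltnNge.
Qed.

Lemma rank_inj A : {in A &, injective (rank A)}.
Proof.
move=> x y xA yA xy; case: (ltngtP x y) => // h.
  by have := rank_lt yA h; rewrite xy ltnn.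
by have := rank_lt xA h; rewrite xy ltnn.
Qed.

Lemma rank_gt0 (A : {fset nat}) x : x \in A -> 0 < rank A x.
Proof.
by move=> xA; rewrite cardfs_gt0; apply/fset0Pn; exists x; rewrite !inE /= xA leqnn.
Qed.

Lemma rank_image (A : {fset nat}) : rank A @` A = ivl 1 #|` A|.
Proof.
apply/eqP; rewrite eqEfcard card_ivl1 card_in_imfset ?leqnn ?andbT; last exact: rank_inj.
apply/fsubsetP => _ /imfsetP[x /= xA ->]; rewrite in_ivl rank_gt0 //=.
by apply: fsubset_leq_card; apply/fsubsetP => y; rewrite !inE /= => /andP[].
Qed.

Lemma std_is_ip (I : IP) : is_ip (std_blocks I).
Proof.
have /is_ipP[hint hdis] := valP I.
have sub E x : E \in blocks I -> x \in E -> x \in ground I.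
  by move=> EI xE; apply/in_fcover; exists E.
apply/is_ipP; split.
  move=> _ /imfsetP[E /= EI ->].
  have /is_intervalP[a [b [/andP[a0 ab] Eab]]] := hint _ EI.
  have rankE y : a <= y <= b -> rank (ground I) y = rank (ground I) a + (y - a).
    elim: y => [|y IHy]; first by lia.
    case: (ltngtP a y.+1) => // [ay|<-] yb; last by rewrite subnn addn0.
    rewrite rankS ?IHy; [lia|lia|].
    by apply: (sub E) => //; rewrite Eab in_ivl; lia.
  apply/is_intervalP; exists (rank (ground I) a), (rank (ground I) a + (b - a)).
  split; first by rewrite rank_gt0 ?leq_addr //; apply: (sub E) => //; rewrite Eab in_ivl; lia.
  apply/fsetP => z; rewrite in_ivl; apply/imfsetP/idP => [[y /=]|hz].
    rewrite Eab in_ivl => /[dup] hy /andP[ay yb] ->; rewrite (rankE y) //.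
    by rewrite leq_addr leq_add2l leq_sub2r.
  have hy : a <= a + (z - rank (ground I) a) <= b.
    by move: hz; generalize (rank (ground I) a) (z : nat) => r w; lia.
  exists (a + (z - rank (ground I) a)) => /=; first by rewrite Eab in_ivl.
  by rewrite rankE // addKn subnKC //; case/andP: hz.
move=> _ _ /imfsetP[E /= EI ->] /imfsetP[F /= FI ->] neq.
have EF : E != F by apply: contraNneq neq => ->.
apply/fdisjointP => _ /imfsetP[x /= xE ->]; apply/imfsetP => -[y /= yF rxy].
have xy : x = y by apply: rank_inj rxy; [exact: sub xE | exact: sub yF].
by have /fdisjointP/(_ _ xE) := hdis _ _ EI FI EF; rewrite xy yF.
Qed.

Lemma std_ground (I : IP) : ground (MkIP (std_is_ip I)) = ivl 1 #|` ground I|.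
Proof.
rewrite -rank_image.
apply/fsetP => z; apply/in_fcover/imfsetP => /=.
  move=> [_ /imfsetP[E /= EI ->] /imfsetP[x /= xE ->]]; exists x => //.
  by apply/in_fcover; exists E.
move=> [x /in_fcover[E EI xE] ->]; exists (rank (ground I) @` E).
  by apply/imfsetP; exists E.
by apply/imfsetP; exists x.
Qed.

Lemma std_is_std (I : IP) : is_std (MkIP (std_is_ip I)).
Proof. by apply/is_stdP; exists #|` ground I|; exact: std_ground. Qed.

Definition std (I : IP) : StIP := MkStIP (std_is_std I).

Lemma size_std (I : IP) : size_st (std I) = #|` ground I|.
Proof. by rewrite /size_st std_ground card_ivl1. Qed.

Lemma stip_ground (s : StIP) : ground s = ivl 1 (size_st s).
Proof. exact/eqP/(valP s). Qed.

Lemma bullet_is_ip (s t : StIP) : is_ip (bullet_blocks s t).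
Proof.
have /is_ipP[sint sdis] := valP (ip s); have /is_ipP[tint tdis] := valP (ip t).
have sub E x : E \in blocks s -> x \in E -> x <= size_st s.
  move=> Es xE; suff: x \in ground s by rewrite stip_ground in_ivl => /andP[].
  by apply/in_fcover; exists E.
have st E F : E \in blocks s -> F \in blocks t ->
    [disjoint E & shift (size_st s) F]%fset.
  move=> Es Ft; apply/fdisjointP => x xE; apply/imfsetP => -[y /= yF xy].
  have /is_intervalP[a [b [/andP[a0 ab] Fab]]] := tint _ Ft.
  by have := sub _ _ Es xE; move: yF; rewrite Fab in_ivl; lia.
apply/is_ipP; split.
  move=> E; rewrite in_fsetU => /orP[/sint //|/imfsetP[F /= Ft ->]].
  have /is_intervalP[a [b [/andP[a0 ab] Fab]]] := tint _ Ft.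
  apply/is_intervalP; exists (size_st s + a), (size_st s + b); split; first by lia.
  apply/fsetP => z; rewrite in_ivl; apply/imfsetP/idP => [[y /=]|hz].
    by rewrite Fab in_ivl => ? ->; lia.
  by exists (z - size_st s); rewrite /= ?Fab ?in_ivl; lia.
move=> E F; rewrite !in_fsetU => /orP[Es|/imfsetP[E' /= Et ->]] /orP[Fs|/imfsetP[F' /= Ft ->]].
- exact: sdis.
- by move=> _; apply: st.
- by move=> _; rewrite fdisjoint_sym; apply: st.
move=> neq; have EF : E' != F' by apply: contraNneq neq => ->.
apply/fdisjointP => _ /imfsetP[x /= xE ->]; apply/imfsetP => -[y /= yF /addnI xy].
by have /fdisjointP/(_ _ xE) := tdis _ _ Et Ft EF; rewrite xy yF.
Qed.

Lemma bullet_ground (s t : StIP) :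
  ground (MkIP (bullet_is_ip s t)) = ivl 1 (size_st s + size_st t).
Proof.
have gs := stip_ground s; have gt := stip_ground t.
apply/fsetP => z; rewrite in_ivl; apply/in_fcover/idP => /=.
  move=> [E]; rewrite in_fsetU => /orP[Es zE|/imfsetP[F /= Ft ->] /imfsetP[y /= yF ->]].
    by have : z \in ground s; [apply/in_fcover; exists E|rewrite gs in_ivl; lia].
  by have : y \in ground t; [apply/in_fcover; exists F|rewrite gt in_ivl; lia].
move=> hz; case: (leqP z (size_st s)) => zs.
  have /in_fcover[E Es zE] : z \in ground s by rewrite gs in_ivl; lia.
  by exists E => //; rewrite in_fsetU Es.
have /in_fcover[F Ft zF] : z - size_st s \in ground t by rewrite gt in_ivl; lia.
exists (shift (size_st s) F); first by rewrite in_fsetU in_imfset ?orbT.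
by apply/imfsetP; exists (z - size_st s) => //=; lia.
Qed.

Lemma bullet_is_std (s t : StIP) : is_std (MkIP (bullet_is_ip s t)).
Proof. by apply/is_stdP; exists (size_st s + size_st t); exact: bullet_ground. Qed.

Definition bullet_st (s t : StIP) : StIP := MkStIP (bullet_is_std s t).

Lemma size_bullet s t : size_st (bullet_st s t) = size_st s + size_st t.
Proof. by rewrite /size_st bullet_ground card_ivl1. Qed.

Lemma ip0_subproof : is_ip fset0.
Proof. by apply/is_ipP; split=> [E|E F]; rewrite inE. Qed.

Lemma st0_subproof : is_std (MkIP ip0_subproof).
Proof. by apply/is_stdP; exists 0; apply/fsetP => x; apply/in_fcover/idP => [[]|]; rewrite ?in_ivl //; lia. Qed.

Definition e_st : StIP := MkStIP st0_subproof.

Lemma glue_ground (I J : IP) : fcover (glue I J) = ground I `|` ground J.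
Proof.
apply/fsetP => x; apply/in_fcover/idP.
  move=> [_ /imfsetP[T /= _ ->] /bigfcupP[X _ xX]].
  have := valP X; rewrite !in_fsetU => /orP[h|h]; apply/orP; [left|right];
    by apply/in_fcover; exists (val X).
move=> h; have [E EB xE] : exists2 E, E \in blocks I `|` blocks J & x \in E.
  move: h; rewrite in_fsetU => /orP[] /in_fcover[E Eb xE]; exists E => //;
    by rewrite in_fsetU Eb ?orbT.
eexists; first by apply/imfsetP; exists [` EB].
by apply/bigfcupP; exists [` EB] => //; rewrite mem_index_enum connect0.
Qed.

End IntervalPartitions.

Section Operations.

Local Notation H_int := {malg rat[StIP]}.
Local Notation H_int2 := {malg rat[(StIP * StIP)%type]}.

Definition bullet : H_int -> H_int -> H_int :=
  bilin_ext (fun s t => << bullet_st s t >>).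

(* If a . b = s, then the sizes of a and b add up to that of s, so that the   *)
(* sum may be restricted to sizes at most that of s; see comul_bullet_stE.    *)
Definition comul_bullet_st (s : StIP) : H_int2 :=
  \sum_(a <- StIP_le (size_st s))
    \sum_(b <- StIP_le (size_st s) | bullet_st a b == s) tens << a >> << b >>.

Definition comul_bullet : H_int -> H_int2 := lin_ext comul_bullet_st.

Definition comul_spade_st (s : StIP) : H_int2 :=
  \sum_(A <- fpowerset (ground s))
    \sum_(A' <- fpowerset (ground s) | A `|` A' == ground s)
      \sum_(I <- IP_on A)
        \sum_(I' <- IP_on A' | glue I I' == blocks s)
          tens << std I >> << std I' >>.

Definition comul_spade : H_int -> H_int2 := lin_ext comul_spade_st.

(* Only the g of size at most that of s plus that of t contribute to the sum  *)
(* over all of StIP; see spade_stE.                                           *)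
Definition spade_st (s t : StIP) : H_int :=
  \sum_(g <- StIP_le (size_st s + size_st t)) (comul_spade_st g)@_(s, t) *: << g >>.

Definition spade : H_int -> H_int -> H_int := bilin_ext spade_st.

Definition unit_int (c : rat) : H_int := c *: << e_st >>.

Definition counit_int (x : H_int) : rat :=
  lin_ext (fun s => (s == e_st)%:R : rat^o) x.

Definition size_grading (n : nat) : H_int -> Prop :=
  basis_span [pred s | s \in StIP_n n].

Definition block_grading (l : nat) : H_int -> Prop :=
  basis_span [pred s | nblocks s == l].

Lemma lin_extU (R : fieldType) (K : choiceType) (V : lmodType R) (f : K -> V) k :
  lin_ext f << k >> = f k.
Proof. by rewrite /lin_ext msuppU oner_eq0 big_seq_fset1 mcoeffUU scale1r. Qed.

Lemma tensU (R : fieldType) (K L : choiceType) (k : K) (l : L) :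
  tens << k >> << l >> = << (k, l) >> :> {malg R[(K * L)%type]}.
Proof. by rewrite /tens /bilin_ext !lin_extU. Qed.

Lemma comul_bullet_stE s a b :
  (comul_bullet_st s)@_(a, b) = (bullet_st a b == s)%:R.
Proof.
rewrite /comul_bullet_st raddf_sum /=.
under eq_bigr do rewrite raddf_sum /=.
under eq_bigr do under eq_bigr do rewrite tensU mcoeffU xpair_eqE.
case: (altP (bullet_st a b =P s)) => [<-|neq]; last first.
  rewrite big1 // => i _; rewrite big1 // => j /eqP ij.
  by case: eqP => // ia; case: eqP => // jb; move: neq; rewrite -ij ia jb eqxx.
rewrite (big_fsetD1 a) /=; last by rewrite mem_StIP_le size_bullet leq_addr.
rewrite [X in _ + X]big1_fset ?addr0; last first.
  by move=> i; rewrite in_fsetD1 => /andP[/negbTE ia _] _; rewrite big1 // => j _; rewrite ia.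
rewrite big_mkcond (big_fsetD1 b) /=; last by rewrite mem_StIP_le size_bullet leq_addl.
rewrite !eqxx big1_fset ?addr0 // => j.
by rewrite in_fsetD1 => /andP[/negbTE -> _] _; rewrite andbF if_same.
Qed.

Lemma spade_stE s t g : (spade_st s t)@_g = (comul_spade_st g)@_(s, t).
Proof.
rewrite /spade_st raddf_sum /=.
under eq_bigr do rewrite mcoeffZ mcoeffU.
case: (leqP (size_st g) (size_st s + size_st t)) => hg.
  rewrite (big_fsetD1 g) ?mem_StIP_le //= eqxx mulr1 big1_fset ?addr0 // => i.
  by rewrite in_fsetD1 => /andP[/negbTE -> _] _; rewrite mulr0.
rewrite big1_fset => [|i]; last first.
  rewrite mem_StIP_le => hi _; case: eqP => [ig|]; rewrite ?mulr0 //.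
  by move: hg hi; rewrite ig ltnNge => /negbTE ->.
rewrite /comul_spade_st !raddf_sum /= big1 // => A _.
rewrite raddf_sum /= big1 // => A' /eqP AA'.
rewrite raddf_sum /= big1_fset // => I; rewrite mem_IP_on => /eqP gI _.
rewrite raddf_sum /= big1_seq // => I' /andP[_]; rewrite mem_IP_on => /eqP gI'.
rewrite tensU mcoeffU xpair_eqE; case: andP => // -[/eqP sI /eqP sI'].
by move: hg; rewrite -sI -sI' !size_std gI gI' /size_st -AA' ltnNge (leq_card_fsetU A A').1.
Qed.

End Operations.

(* Main.v *)
(* Coding a point of [n] by whether it is absent from the ground set, starts a
   block, or continues the block of its predecessor turns an interval partition
   of a subset of [n] into a word of length n over a three-letter alphabet.
   Gluing becomes the letterwise join, standardization the deletion of the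
   absent letters, and the bullet product the concatenation of binary words.
   The spade coproduct is then computed letter by letter, its only memory being
   whether the previous point is present on either side. Hence it is
   multiplicative for concatenation, and it is coassociative because both
   iterated coproducts enumerate the triples of words with the given join.
   The second bialgebra is the graded dual of the first; its antipode comes from
   the usual recursion along a connected grading. *)
Require Import Defs.
From mathcomp Require Import all_boot all_order all_algebra.
From mathcomp Require Import finmap zify.
From mathcomp.multinomials Require Import monalg.

Set Implicit Arguments.
Unset Strict Implicit.
Unset Printing Implicit Defensive.

Import GRing.Theory.
Local Open Scope fset_scope.
Local Open Scope ring_scope.

(** * Linear maps on free modules *)

Section LinearExtension.
Variable R : fieldType.

(** A partition is determined by its ground set and by the links between consecutive points of one
    block. Gluing unites the ground sets and unites the links, which is why [None] is neutral and
    [Some false] absorbing in [join]. A link presupposes that the previous point is present, and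
    this is the one constraint that is not letterwise. It disappears where the glued partition
    starts a block, since a join equal to [Some true] contains no [Some false]; so the memory is
    reset where two words are concatenated. In an iterated coproduct the inner splitting sees only
    the surviving letters, hence its memory may refer to a point further back; this is harmless
    because after a gap the outer word cannot continue a block. The antipode recursion runs along
    the degrees in the coproduct. In [comul_bullet] the sizes of the two factors add up exactly,
    whereas [spade] only bounds sizes, overlapping points being counted once; so the recursion is
    built on the homogeneity of the coproduct. *)

Lemma lin_ext_subset (K : choiceType) (V : lmodType R) (f : K -> V) x
    (d : {fset K}) :
  msupp x `<=` d -> lin_ext f x = \sum_(k <- d) x@_k *: f k.
Proof.
move=> xd; apply: big_fset_incl => // k _ /mcoeff_outdom ->.
by rewrite scale0r.
Qed.

Lemma lin_extP (K : choiceType) (V : lmodType R) (f : K -> V) : linear (lin_ext f).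
Proof.
move=> c x y; pose d := msupp (c *: x + y) `|` msupp x `|` msupp y.
rewrite !(@lin_ext_subset _ _ _ _ d) ?fsubsetUr //; first last.
- by rewrite /d -fsetUA fsubsetUl.
- by rewrite /d -fsetUA fsetUCA fsubsetUl.
rewrite scaler_sumr -big_split; apply: eq_bigr => k _ /=.
by rewrite mcoeffD mcoeffZ scalerDl scalerA.
Qed.

Lemma malg_sum (K : choiceType) (x : {malg R[K]}) :
  x = \sum_(k <- msupp x) x@_k *: << k >>.
Proof.
rewrite {1}[x]monalgE; apply: eq_bigr => k _; apply/malgP => j.
by rewrite mcoeffZ !mcoeffU; case: eqP => _; rewrite ?mulr1n ?mulr0n ?mulr1 ?mulr0.
Qed.

(** The bialgebra records state linearity as a bare predicate, so sums and scalars are pulled out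
    here without bundled linear maps. *)
Lemma linearP_sum (U V : lmodType R) (F : U -> V) (hF : linear F) (I : Type)
    (r : seq I) (P : pred I) (G : I -> U) :
  F (\sum_(i <- r | P i) G i) = \sum_(i <- r | P i) F (G i).
Proof.
(* Linearity at [-1], 0, 0 reads [F 0 = - F 0 + F 0]. *)
have F0 : F 0 = 0.
  have := hF (-1) 0 0; rewrite scaler0 addr0 scaleN1r => h.
  by rewrite h addNr.
apply: (big_morph F) => // x y.
by have := hF 1 x y; rewrite !scale1r.
Qed.

Lemma linearP_scale (U V : lmodType R) (F : U -> V) (hF : linear F) c x :
  F (c *: x) = c *: F x.
Proof.
have F0 : F 0 = 0.
  have := hF (-1) 0 0; rewrite scaler0 addr0 scaleN1r => h.
  by rewrite h addNr.
by have := hF c x 0; rewrite !addr0 F0 addr0.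
Qed.

Lemma linear_lin_ext (K : choiceType) (V : lmodType R) (F : {malg R[K]} -> V) x :
  linear F -> F x = lin_ext (fun k => F << k >>) x.
Proof.
move=> hF; rewrite {1}[x]malg_sum (linearP_sum hF).
by apply: eq_bigr => k _; rewrite (linearP_scale hF).
Qed.

(** Reduces the multilinear identities below to basis elements, one variable at a time. *)
Lemma linear_ext (K : choiceType) (V : lmodType R) (F G : {malg R[K]} -> V) :
  linear F -> linear G -> (forall k, F << k >> = G << k >>) -> F =1 G.
Proof.
move=> hF hG FG x; rewrite (linear_lin_ext x hF) (linear_lin_ext x hG).
by apply: eq_bigr => k _; rewrite FG.
Qed.

Lemma bilin_extPl (K L : choiceType) (V : lmodType R) (f : K -> L -> V) y :
  linear ((bilin_ext f)^~ y).
Proof. exact: lin_extP. Qed.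

Lemma bilin_extPr (K L : choiceType) (V : lmodType R) (f : K -> L -> V) x :
  linear (bilin_ext f x).
Proof.
move=> c y z; rewrite /bilin_ext /lin_ext scaler_sumr -big_split /=.
apply: eq_bigr => k _; rewrite -/(lin_ext _ _) lin_extP scalerDr.
by rewrite !scalerA mulrC.
Qed.

Lemma bilin_extU (K L : choiceType) (V : lmodType R) (f : K -> L -> V) k l :
  bilin_ext f << k >> << l >> = f k l.
Proof. by rewrite /bilin_ext !lin_extU. Qed.

Lemma tensPl (K L : choiceType) (y : {malg R[L]}) :
  linear (fun x : {malg R[K]} => tens x y).
Proof. exact: bilin_extPl. Qed.

Lemma tensPr (K L : choiceType) (x : {malg R[K]}) :
  linear (fun y : {malg R[L]} => tens x y).
Proof. exact: bilin_extPr. Qed.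

(** With [R^o] as target, identities between scalars also fall under [linear_ext]. *)
Lemma mcoeffP (K : choiceType) (k : K) :
  linear (fun x : {malg R[K]} => x@_k : R^o).
Proof. by move=> c x y; rewrite mcoeffD mcoeffZ. Qed.

Lemma mcoeff_tens (K L : choiceType) (x : {malg R[K]}) (y : {malg R[L]}) k l :
  (tens x y)@_(k, l) = x@_k * y@_l.
Proof.
move: x; apply: (@linear_ext _ R^o) => [c x z|c x z|a] /=.
- by rewrite tensPl mcoeffP.
- by rewrite mcoeffD mcoeffZ mulrDl -mulrA.
move: y; apply: (@linear_ext _ R^o) => [c x z|c x z|b] /=.
- by rewrite tensPr mcoeffP.
- by rewrite mcoeffD mcoeffZ mulrDr mulrCA.
by rewrite tensU !mcoeffU xpair_eqE -!mulnb natrM.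
Qed.

Lemma tens_mulPl (K : choiceType) (m : {malg R[K]} -> {malg R[K]} -> {malg R[K]}) y :
  linear ((tens_mul m)^~ y).
Proof. exact: bilin_extPl. Qed.

Lemma tens_mulPr (K : choiceType) (m : {malg R[K]} -> {malg R[K]} -> {malg R[K]}) x :
  linear (tens_mul m x).
Proof. exact: bilin_extPr. Qed.

Lemma tens_mapP (K K' L L' : choiceType)
    (f : {malg R[K]} -> {malg R[K']}) (g : {malg R[L]} -> {malg R[L']}) :
  linear (tens_map f g).
Proof. exact: lin_extP. Qed.

Lemma tens_mapU (K K' L L' : choiceType)
    (f : {malg R[K]} -> {malg R[K']}) (g : {malg R[L]} -> {malg R[L']}) k l :
  tens_map f g << (k, l) >> = tens (f << k >>) (g << l >>).
Proof. by rewrite /tens_map /tens_lift lin_extU. Qed.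

Lemma tens_liftP (K L : choiceType) (V : lmodType R)
    (f : {malg R[K]} -> {malg R[L]} -> V) : linear (tens_lift f).
Proof. exact: lin_extP. Qed.

Lemma tens_liftU (K L : choiceType) (V : lmodType R)
    (f : {malg R[K]} -> {malg R[L]} -> V) k l :
  tens_lift f << (k, l) >> = f << k >> << l >>.
Proof. by rewrite /tens_lift lin_extU. Qed.

(** [tens_lift] evaluates [f] on pairs of basis elements only; bilinearity carries this over to all
    pure tensors. *)
Lemma tens_lift_tens (K L : choiceType) (V : lmodType R)
    (f : {malg R[K]} -> {malg R[L]} -> V) x y :
  (forall z, linear (f^~ z)) -> (forall z, linear (f z)) ->
  tens_lift f (tens x y) = f x y.
Proof.
move=> fl fr; move: x; apply: linear_ext => [c x z|c x z|a] /=; last first.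
- move: y; apply: linear_ext => [c x z|c x z|b] /=; last by rewrite tensU tens_liftU.
  + by rewrite tensPr tens_liftP.
  + by rewrite fr.
- by rewrite fl.
- by rewrite tensPl tens_liftP.
Qed.

Lemma tens_mulU (K : choiceType) (m : {malg R[K]} -> {malg R[K]} -> {malg R[K]})
    a b c d :
  tens_mul m << (a, b) >> << (c, d) >>
  = tens (m << a >> << c >>) (m << b >> << d >>).
Proof. exact: bilin_extU. Qed.

Lemma tens_assocP (K L M : choiceType) :
  linear (@tens_assoc R K L M).
Proof. exact: lin_extP. Qed.

Lemma tens_assocU (K L M : choiceType) (k : K) (l : L) (n : M) :
  tens_assoc << ((k, l), n) >> = << (k, (l, n)) >> :> {malg R[_]}.
Proof. exact: lin_extU. Qed.

Lemma mcoeff_assoc (K L M : choiceType) (x : {malg R[((K * L) * M)%type]}) k l n :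
  (tens_assoc x)@_(k, (l, n)) = x@_((k, l), n).
Proof.
move: x; apply: (@linear_ext _ R^o) => [c x z|c x z|[[a b] d]] /=.
- by rewrite tens_assocP mcoeffP.
- by rewrite mcoeffP.
by rewrite tens_assocU !mcoeffU !xpair_eqE andbA.
Qed.

End LinearExtension.

(** * Duality of bialgebras *)

Section Duality.
Variables (R : fieldType) (K : choiceType).
Local Notation H := {malg R[K]}.
Local Notation HH := {malg R[(K * K)%type]}.

Definition pair_malg (L : choiceType) (x y : {malg R[L]}) : R^o :=
  lin_ext (fun k => y@_k : R^o) x.

Lemma pair_malgPl (L : choiceType) (y : {malg R[L]}) : linear (fun x => pair_malg x y).
Proof. exact: lin_extP. Qed.

Lemma pair_malgPr (L : choiceType) (x : {malg R[L]}) : linear (pair_malg x).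
Proof.
move=> c y z; rewrite /pair_malg /lin_ext scaler_sumr -big_split /=.
by apply: eq_bigr => k _; rewrite mcoeffP scalerDr !scalerA mulrC.
Qed.

Lemma pair_malgUl (L : choiceType) (y : {malg R[L]}) k : pair_malg << k >> y = y@_k.
Proof. exact: lin_extU. Qed.

Lemma pair_malgUr (L : choiceType) (x : {malg R[L]}) k : pair_malg x << k >> = x@_k.
Proof.
move: x; apply: (@linear_ext R _ R^o) => [c x z|c x z|j] /=.
- by rewrite pair_malgPl.
- by rewrite mcoeffP.
by rewrite pair_malgUl !mcoeffU eq_sym.
Qed.

(* (a (x) b) (x) (c (x) d) |-> (a (x) c) (x) (b (x) d) *)
Definition mid_swap : {malg R[((K * K) * (K * K))%type]} ->
    {malg R[((K * K) * (K * K))%type]} :=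
  lin_ext (fun q => << ((q.1.1, q.2.1), (q.1.2, q.2.2)) >>).

Lemma mcoeff_mid_swap x a b c d :
  (mid_swap x)@_((a, b), (c, d)) = x@_((a, c), (b, d)).
Proof.
move: x; apply: (@linear_ext R _ R^o) => [k x z|k x z|[[i j] [l n]]] /=.
- by rewrite /mid_swap lin_extP mcoeffP.
- by rewrite mcoeffP.
rewrite /mid_swap lin_extU !mcoeffU !xpair_eqE /=; congr (_ *+ nat_of_bool _).
by case: (i == a) => //=; case: (l == b) => //=; rewrite andbF.
Qed.

Variables (m m' : H -> H -> H) (D D' : H -> HH) (u : R -> H) (eps : H -> R) (e : K).
Hypothesis bialg : is_bialgebra m D u eps.
Hypothesis uE : forall c, u c = c *: << e >>.
Hypothesis epsE : forall x, eps x = x@_e.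
Hypothesis m'l : forall y, linear (m'^~ y).
Hypothesis m'r : forall x, linear (m' x).
Hypothesis D'l : linear D'.
(** Duality is stated coefficient by coefficient, so no dual space is formed: that the transposed
    maps have finitely supported values is carried by their types. *)
Hypothesis m'E : forall s t g, (m' << s >> << t >>)@_g = (D << g >>)@_(s, t).
Hypothesis D'E : forall g s t, (D' << g >>)@_(s, t) = (m << s >> << t >>)@_g.

Let alg := bialg_alg bialg.
Let coalg := bialg_coalg bialg.
Let ml := alg_linear_l alg.
Let mr := alg_linear_r alg.
Let Dl := coalg_linear coalg.

Lemma pair_dual_mul x y g : (m' x y)@_g = pair_malg (tens x y) (D << g >>).
Proof.
move: x; apply: (@linear_ext R _ R^o) => [c x z|c x z|a] /=.
- by rewrite m'l mcoeffP.
- by rewrite tensPl pair_malgPl.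
move: y; apply: (@linear_ext R _ R^o) => [c x z|c x z|b] /=.
- by rewrite m'r mcoeffP.
- by rewrite tensPr pair_malgPl.
by rewrite tensU pair_malgUl m'E.
Qed.

Lemma pair_dual_comul x y g : (m x y)@_g = pair_malg (tens x y) (D' << g >>).
Proof.
move: x; apply: (@linear_ext R _ R^o) => [c x z|c x z|a] /=.
- by rewrite ml mcoeffP.
- by rewrite tensPl pair_malgPl.
move: y; apply: (@linear_ext R _ R^o) => [c x z|c x z|b] /=.
- by rewrite mr mcoeffP.
- by rewrite tensPr pair_malgPl.
by rewrite tensU pair_malgUl D'E.
Qed.

(** The coefficient of [g] in either product of [a], [b], [d] is that of [(a, (b, d))] in an
    iterated coproduct of [g], so coassociativity transposes to associativity. *)
Lemma dual_mulA : associative m'.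
Proof.
move=> x y z.
move: x; apply: linear_ext => [c x w|c x w|a] /=; [by rewrite m'l|by rewrite !m'l|].
move: y; apply: linear_ext => [c x w|c x w|b] /=.
- by rewrite m'l m'r.
- by rewrite m'r m'l.
move: z; apply: linear_ext => [c x w|c x w|d] /=; [by rewrite !m'r|by rewrite m'r|].
apply/malgP => g; rewrite !pair_dual_mul.
have l1 z : pair_malg (tens (m' << a >> << b >>) << d >>) z
          = (tens_assoc (tens_map D id z))@_(a, (b, d)).
  move: z; apply: (@linear_ext R _ R^o) => [c x w|c x w|[i j]] /=.
  - by rewrite pair_malgPr.
  - by rewrite tens_mapP tens_assocP mcoeffP.
  rewrite pair_malgUr mcoeff_assoc tens_mapU !mcoeff_tens m'E !mcoeffU.
  by rewrite eq_sym.
have l2 z : pair_malg (tens << a >> (m' << b >> << d >>)) z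
          = (tens_map id D z)@_(a, (b, d)).
  move: z; apply: (@linear_ext R _ R^o) => [c x w|c x w|[i j]] /=.
  - by rewrite pair_malgPr.
  - by rewrite tens_mapP mcoeffP.
  rewrite pair_malgUr tens_mapU !mcoeff_tens m'E !mcoeffU.
  by rewrite eq_sym.
by rewrite l1 l2 (coalg_coassoc coalg).
Qed.

Lemma dual_coassoc x : tens_assoc (tens_map D' id (D' x)) = tens_map id D' (D' x).
Proof.
move: x; apply: linear_ext => [c x w|c x w|g] /=.
- by rewrite D'l tens_mapP tens_assocP.
- by rewrite D'l tens_mapP.
apply/malgP => -[a [b d]].
have l1 z : pair_malg (tens (m << a >> << b >>) << d >>) z
          = (tens_assoc (tens_map D' id z))@_(a, (b, d)).
  move: z; apply: (@linear_ext R _ R^o) => [c x w|c x w|[i j]] /=.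
  - by rewrite pair_malgPr.
  - by rewrite tens_mapP tens_assocP mcoeffP.
  rewrite pair_malgUr mcoeff_assoc tens_mapU !mcoeff_tens D'E !mcoeffU.
  by rewrite eq_sym.
have l2 z : pair_malg (tens << a >> (m << b >> << d >>)) z
          = (tens_map id D' z)@_(a, (b, d)).
  move: z; apply: (@linear_ext R _ R^o) => [c x w|c x w|[i j]] /=.
  - by rewrite pair_malgPr.
  - by rewrite tens_mapP mcoeffP.
  rewrite pair_malgUr tens_mapU !mcoeff_tens D'E !mcoeffU.
  by rewrite eq_sym.
by rewrite -l1 -l2 -!pair_dual_comul (alg_mulA alg).
Qed.

(* Both sides are the contraction of [D' x (x) D' y] with [D g (x) D h], the
   middle factors being exchanged. *)
Lemma dual_comulM : {morph D' : x y / m' x y >-> tens_mul m' x y}.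
Proof.
move=> x y.
move: x; apply: linear_ext => [c x w|c x w|s] /=.
- by rewrite m'l D'l.
- by rewrite D'l tens_mulPl.
move: y; apply: linear_ext => [c x w|c x w|t] /=.
- by rewrite m'r D'l.
- by rewrite D'l tens_mulPr.
apply/malgP => -[g h].
(* The [(g, h)] coefficient on the left is the pairing of [m' s t] with [m g h], hence also the
   [(s, t)] coefficient of [D (m g h)], where multiplicativity of [D] applies. *)
have l1 x : pair_malg x (m << g >> << h >>) = (D' x)@_(g, h).
  move: x; apply: (@linear_ext R _ R^o) => [c x w|c x w|f] /=.
  - by rewrite pair_malgPl.
  - by rewrite D'l mcoeffP.
  by rewrite pair_malgUl D'E.
have l2 x : pair_malg (m' << s >> << t >>) x = (D x)@_(s, t).
  move: x; apply: (@linear_ext R _ R^o) => [c x w|c x w|f] /=.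
  - by rewrite pair_malgPr.
  - by rewrite Dl mcoeffP.
  by rewrite pair_malgUr m'E.
rewrite -l1 l2 (bialg_comulM bialg).
have l3 z w : (tens_mul m' z w)@_(g, h)
    = pair_malg (mid_swap (tens z w)) (tens (D << g >>) (D << h >>)).
  move: z; apply: (@linear_ext R _ R^o) => [c x z|c x z|[a b]] /=.
  - by rewrite tens_mulPl mcoeffP.
  - by rewrite tensPl /mid_swap lin_extP pair_malgPl.
  move: w; apply: (@linear_ext R _ R^o) => [k x z|k x z|[c d]] /=.
  - by rewrite tens_mulPr mcoeffP.
  - by rewrite tensPr /mid_swap lin_extP pair_malgPl.
  rewrite tens_mulU tensU /mid_swap lin_extU pair_malgUl !mcoeff_tens /=.
  by rewrite !m'E.
have l4 z w : (tens_mul m z w)@_(s, t)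
    = pair_malg (mid_swap (tens (D' << s >>) (D' << t >>))) (tens z w).
  move: z; apply: (@linear_ext R _ R^o) => [c x z|c x z|[a b]] /=.
  - by rewrite tens_mulPl mcoeffP.
  - by rewrite tensPl pair_malgPr.
  move: w; apply: (@linear_ext R _ R^o) => [k x z|k x z|[c d]] /=.
  - by rewrite tens_mulPr mcoeffP.
  - by rewrite tensPr pair_malgPr.
  rewrite tens_mulU tensU pair_malgUr mcoeff_mid_swap !mcoeff_tens /=.
  by rewrite !D'E.
by rewrite l3 l4.
Qed.

(** Transposition exchanges the axioms: the unit laws of [m'] come from the counit laws of [D], the
    counit laws of [D'] from the unit laws of [m], the value [D' (u 1)] from multiplicativity of
    [eps], and the latter for [m'] from [D (u 1)]. *)
Lemma dual_bialgebra : is_bialgebra m' D' u eps.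
Proof.
have unit_oneE : u 1 = << e >> by rewrite uE scale1r.
have lift_l z k : (tens_lift (fun a b => eps a *: b) z)@_k = z@_(e, k).
  move: z; apply: (@linear_ext R _ R^o) => [c x w|c x w|[a b]] /=.
  - by rewrite tens_liftP mcoeffP.
  - by rewrite mcoeffP.
  by rewrite tens_liftU mcoeffZ epsE !mcoeffU xpair_eqE -mulnb natrM.
have lift_r z k : (tens_lift (fun a b => eps b *: a) z)@_k = z@_(k, e).
  move: z; apply: (@linear_ext R _ R^o) => [c x w|c x w|[a b]] /=.
  - by rewrite tens_liftP mcoeffP.
  - by rewrite mcoeffP.
  by rewrite tens_liftU mcoeffZ epsE !mcoeffU xpair_eqE -mulnb natrM mulrC.
split.
- split => //.
  + by move=> c x y; rewrite !uE scalerDl scalerA.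
  + exact: dual_mulA.
  + rewrite unit_oneE; apply: linear_ext => // s; apply/malgP => g.
    by rewrite m'E -lift_l (coalg_counit_l coalg) !mcoeffU eq_sym.
  + rewrite unit_oneE; apply: linear_ext => // s; apply/malgP => g.
    by rewrite m'E -lift_r (coalg_counit_r coalg) !mcoeffU eq_sym.
- split => //.
  + exact: coalg_counit_linear coalg.
  + exact: dual_coassoc.
  + apply: linear_ext => [c x w|//|s] /=; first by rewrite D'l tens_liftP.
    apply/malgP => k; rewrite lift_l D'E -unit_oneE (alg_mul1x alg) !mcoeffU.
    by rewrite eq_sym.
  + apply: linear_ext => [c x w|//|s] /=; first by rewrite D'l tens_liftP.
    apply/malgP => k; rewrite lift_r D'E -unit_oneE (alg_mulx1 alg) !mcoeffU.
    by rewrite eq_sym.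
- exact: dual_comulM.
- rewrite unit_oneE; apply/malgP => -[s t].
  rewrite D'E mcoeff_tens -epsE (bialg_counitM bialg) !epsE !mcoeffU.
  by rewrite ![e == _]eq_sym.
- move=> x y; rewrite !epsE pair_dual_mul -unit_oneE (bialg_comul1 bialg) unit_oneE tensU.
  by rewrite pair_malgUr mcoeff_tens.
- by rewrite unit_oneE epsE mcoeffUU.
Qed.

End Duality.

(** * Antipodes of connected bialgebras *)

Section Antipode.
Variables (R : fieldType) (K : choiceType).
Local Notation H := {malg R[K]}.
Local Notation HH := {malg R[(K * K)%type]}.
Variables (m : H -> H -> H) (D : H -> HH) (u : R -> H) (eps : H -> R) (e : K).
Variable deg : K -> nat.
Hypothesis bialg : is_bialgebra m D u eps.
Hypothesis uE : forall c, u c = c *: << e >>.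
Hypothesis epsE : forall x, eps x = x@_e.
Hypothesis deg_eq0 : forall k, deg k = 0%N -> k = e.
Hypothesis degD : forall s p, p \in msupp (D << s >>) -> (deg p.1 + deg p.2)%N = deg s.

Let alg := bialg_alg bialg.
Let coalg := bialg_coalg bialg.
Let ml := alg_linear_l alg.
Let mr := alg_linear_r alg.
Let Dl := coalg_linear coalg.

(** The convolution product, for which an antipode is a two-sided inverse of [id] and [u \o eps] is
    the unit. *)
Definition conv (f g : H -> H) (x : H) : H := tens_lift m (tens_map f g (D x)).

Lemma convP f g : linear (conv f g).
Proof. by move=> c x y; rewrite /conv Dl tens_mapP tens_liftP. Qed.

Lemma eq_conv f f' g g' : f =1 f' -> g =1 g' -> conv f g =1 conv f' g'.
Proof.
move=> ff' gg' x; rewrite /conv; set z := D x.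
have -> : tens_map f g z = tens_map f' g' z; last by [].
by apply: eq_bigr => k _; rewrite ff' gg'.
Qed.

Lemma conv_assoc f g h x : linear f -> linear g -> linear h ->
  conv (conv f g) h x = conv f (conv g h) x.
Proof.
move=> hf hg hh.
(* Both sides are the threefold product [T] applied to an iterated coproduct of [x]. *)
pose T := lin_ext (fun q : K * (K * K) =>
  m (f << q.1 >>) (m (g << q.2.1 >>) (h << q.2.2 >>))).
have TP : linear T := @lin_extP _ _ _ _.
transitivity (T (tens_assoc (tens_map D id (D x)))).
  rewrite /conv; move: (D x); apply: linear_ext => [c y z|c y z|[a b]] /=.
  - by rewrite tens_mapP tens_liftP.
  - by rewrite tens_mapP tens_assocP TP.
  rewrite !tens_mapU tens_lift_tens //.
  move: (D << a >>); apply: linear_ext => [c y z|c y z|[i j]] /=.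
  - by rewrite tens_mapP tens_liftP ml.
  - by rewrite tensPl tens_assocP TP.
  rewrite tensU tens_assocU /T lin_extU tens_mapU tens_lift_tens //=.
  by rewrite (alg_mulA alg).
rewrite (coalg_coassoc coalg) /conv.
move: (D x); apply: linear_ext => [c y z|c y z|[a b]] /=.
- by rewrite tens_mapP TP.
- by rewrite tens_mapP tens_liftP.
rewrite !tens_mapU tens_lift_tens //.
move: (D << b >>); apply: linear_ext => [c y z|c y z|[i j]] /=.
- by rewrite tensPr TP.
- by rewrite tens_mapP tens_liftP mr.
by rewrite tensU /T lin_extU tens_mapU tens_lift_tens.
Qed.

Lemma unit_oneE : u 1 = << e >>.
Proof. by rewrite uE scale1r. Qed.

Lemma counitP : linear (fun x => u (eps x)).
Proof.
by move=> c x y; rewrite !uE !epsE mcoeffD mcoeffZ scalerDl scalerA.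
Qed.

Lemma conv1f f x : linear f -> conv (fun y => u (eps y)) f x = f x.
Proof.
move=> hf; rewrite -{2}[x](coalg_counit_l coalg) /conv.
move: (D x); apply: linear_ext => [c y z|c y z|[a b]] /=.
- by rewrite tens_mapP tens_liftP.
- by rewrite tens_liftP hf.
rewrite tens_mapU tens_lift_tens // tens_liftU uE (linearP_scale (ml _)).
by rewrite -unit_oneE (alg_mul1x alg) (linearP_scale hf).
Qed.

Lemma convf1 f x : linear f -> conv f (fun y => u (eps y)) x = f x.
Proof.
move=> hf; rewrite -{2}[x](coalg_counit_r coalg) /conv.
move: (D x); apply: linear_ext => [c y z|c y z|[a b]] /=.
- by rewrite tens_mapP tens_liftP.
- by rewrite tens_liftP hf.
rewrite tens_mapU tens_lift_tens // tens_liftU uE (linearP_scale (mr _)).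
by rewrite -unit_oneE (alg_mulx1 alg) (linearP_scale hf).
Qed.

(** Contracting the right factor with [eps] keeps exactly the terms whose right factor is [e], so
    this is the counit law. *)
Lemma comul_coef_unit s a : (D << s >>)@_(a, e) = (a == s)%:R.
Proof.
have lift_r z k : (tens_lift (fun a b => eps b *: a) z)@_k = z@_(k, e).
  move: z; apply: (@linear_ext R _ R^o) => [c x w|c x w|[i j]] /=.
  - by rewrite tens_liftP mcoeffP.
  - by rewrite mcoeffP.
  by rewrite tens_liftU mcoeffZ epsE !mcoeffU xpair_eqE -mulnb natrM mulrC.
by rewrite -lift_r (coalg_counit_r coalg) mcoeffU eq_sym.
Qed.

(** A right factor of degree 0 would be [e], and [comul_coef_unit] leaves only the left factor [s]
    for it. *)
Lemma comul_deg_lt s p : p \in msupp (D << s >>) -> p.1 != s -> (deg p.1 < deg s)%N.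
Proof.
case: p => a b /= pD nas; have /= dab := degD pD.
case: (posnP (deg b)) => [/deg_eq0 be|]; last by lia.
by move: pD; rewrite -mcoeff_neq0 be comul_coef_unit (negbTE nas) eqxx.
Qed.

(* [n] is fuel, sufficient once it exceeds [deg s]. *)
Fixpoint conv_linv_rec (f : K -> H) (n : nat) (s : K) : H :=
  if n is n'.+1 then
    if s == e then << e >> else
    - \sum_(p <- msupp (D << s >>) | p.1 != s)
        (D << s >>)@_p *: m (conv_linv_rec f n' p.1) (f p.2)
  else 0.

Lemma conv_linv_recE f n n' s : (deg s < n)%N -> (deg s < n')%N ->
  conv_linv_rec f n s = conv_linv_rec f n' s.
Proof.
elim: n n' s => [//|n IH] [//|n'] s; rewrite !ltnS => sn sn' /=.
case: eqP => // _; congr (- _).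
rewrite big_seq_cond [RHS]big_seq_cond; apply: eq_bigr => p /andP[pD ps].
have lt := comul_deg_lt pD ps.
by rewrite (IH n') //; [apply: leq_trans sn|apply: leq_trans sn'].
Qed.

(** In the equation [conv g f s = 0] for [s != e], the term of [(s, e)] is [g s] itself because [f]
    fixes [e], and the other terms involve [g] in smaller degree only; the equation can be solved
    for [g s]. *)
Lemma conv_linv_exists (f : H -> H) : linear f -> f << e >> = << e >> ->
  exists g, [/\ linear g, g << e >> = << e >>
              & forall x, conv g f x = u (eps x)].
Proof.
move=> hf fe; pose g0 s := conv_linv_rec (fun k => f << k >>) (deg s).+1 s.
have g0e : g0 e = << e >> by rewrite /g0 /= eqxx.
exists (lin_ext g0); split; [exact: lin_extP|by rewrite lin_extU|].
apply: linear_ext => [||s]; [exact: convP|exact: counitP|].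
have Eg : conv (lin_ext g0) f << s >>
    = \sum_(p <- msupp (D << s >>)) (D << s >>)@_p *: m (g0 p.1) (f << p.2 >>).
  rewrite /conv {1}[D _]malg_sum (linearP_sum (@tens_mapP _ _ _ _ _ _ _)).
  rewrite (linearP_sum (@tens_liftP _ _ _ _ _)); apply: eq_bigr => -[a b] _.
  rewrite (linearP_scale (@tens_mapP _ _ _ _ _ _ _)).
  rewrite (linearP_scale (@tens_liftP _ _ _ _ _)) tens_mapU.
  by rewrite tens_lift_tens // lin_extU.
rewrite Eg epsE mcoeffU uE; case: (altP (s =P e)) => [->|nse].
  rewrite -{1 2}unit_oneE (bialg_comul1 bialg) unit_oneE tensU msuppU oner_eq0 big_seq_fset1.
  by rewrite mcoeffUU !scale1r /= g0e fe -unit_oneE (alg_mul1x alg).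
rewrite scale0r.
have sD : (s, e) \in msupp (D << s >>).
  by rewrite -mcoeff_neq0 comul_coef_unit eqxx oner_eq0.
(* By degree, a term with left factor [s] has right factor [e], so this half of the sum is the term
   of [(s, e)]. *)
rewrite (bigID (fun p => p.1 == s)) /= big_mkcond (big_fsetD1 (s, e)) //=.
rewrite big1_fset /= => [|[a b]]; last first.
  rewrite !inE xpair_eqE => /andP[/= nb pD] _; case: eqP => // ea; move: nb pD.
  rewrite {}ea eqxx /= => nb /degD /= db; case/eqP: nb; apply: deg_eq0.
  by lia.
rewrite eqxx addr0 comul_coef_unit eqxx scale1r fe -unit_oneE (alg_mulx1 alg).
rewrite {1}/g0 /= (negbTE nse); apply/eqP; rewrite addrC subr_eq0; apply/eqP.
rewrite big_seq_cond [RHS]big_seq_cond; apply: eq_bigr => p /andP[pD ps].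
by rewrite (@conv_linv_recE _ _ (deg p.1).+1) // (comul_deg_lt pD ps).
Qed.

(* A left inverse [S] of [id] sends [e] to [e], so it has a left inverse [T] as
   well, and [T = T * S * id = id]. *)
Lemma connected_antipode : exists S, is_antipode m D u eps S.
Proof.
have idl : linear (@id H) by [].
have [S [Sl Se SI]] := conv_linv_exists idl erefl.
have [T [Tl _ TS]] := conv_linv_exists Sl Se.
have TE x : T x = x.
  rewrite -[RHS](conv1f _ idl) -[LHS](convf1 _ Tl).
  transitivity (conv (conv T S) id x); last exact: (eq_conv TS (frefl id)).
  rewrite (conv_assoc _ Tl Sl idl).
  exact: (eq_conv (frefl T) (fun y => esym (SI y))).
exists S; split; [exact: Sl|exact: SI|] => x.
rewrite -TS; exact: (eq_conv (fun y => esym (TE y)) (frefl S)).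
Qed.

End Antipode.

(** * Filtrations by degree *)

Section Filtration.
Variables (R : fieldType) (K : choiceType) (deg : K -> nat).
Local Notation H := {malg R[K]}.
Local Notation HH := {malg R[(K * K)%type]}.

Lemma grading_filtrationP n (x : H) (V : nat -> H -> Prop) :
  (forall k y, V k y <-> basis_span (fun s => deg s == k) y) ->
  grading_filtration V n x <-> basis_span (fun s => (deg s <= n)%N) x.
Proof.
move=> VE; split=> [[v Vv ->] k|xn].
  rewrite -mcoeff_neq0 raddf_sum /=; apply: contraNT => nk.
  rewrite big1 // => i _; apply/mcoeff_outdom/negP => ki.
  have /VE/(_ _ ki)/eqP dk := Vv i.
  by case/negP: nk; rewrite dk -ltnS.
(* The homogeneous components of [x]. *)
exists (fun i => \sum_(k <- msupp x | deg k == i) x@_k *: << k >>).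
  move=> i; apply/VE => k; rewrite -mcoeff_neq0 raddf_sum /=.
  apply: contraNT => nk; rewrite big1 // => j /eqP ji.
  rewrite mcoeffZ mcoeffU; case: eqP => [jk|]; last by rewrite mulr0.
  by case/eqP: nk; rewrite -jk.
rewrite {1}[x]malg_sum.
under [RHS]eq_bigr do rewrite big_mkcond /=.
rewrite exchange_big /= big_seq [RHS]big_seq; apply: eq_bigr => k /xn.
rewrite -ltnS => kn; rewrite (bigD1 (Ordinal kn)) //= eqxx big1 ?addr0 // => i.
by rewrite -val_eqE /= eq_sym => /negbTE ->.
Qed.

Lemma msupp_lin_ext (V : choiceType) (f : K -> {malg R[V]}) x j :
  j \in msupp (lin_ext f x) -> exists2 k, k \in msupp x & j \in msupp (f k).
Proof.
move=> hj; case: (boolP (has (fun k => j \in msupp (f k)) (msupp x))).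
  by case/hasP => k; exists k.
move=> /hasPn no; move: hj; rewrite -mcoeff_neq0 /lin_ext raddf_sum /= big1_seq ?eqxx //.
by move=> k /andP[_ /no kj]; rewrite mcoeffZ (mcoeff_outdom kj) mulr0.
Qed.

Lemma filtered_of_deg (m : H -> H -> H) (D : H -> HH) (F : nat -> H -> Prop) :
  (forall n x, F n x <-> basis_span (fun s => (deg s <= n)%N) x) ->
  (forall y, linear (m^~ y)) -> (forall x, linear (m x)) -> linear D ->
  (forall s t g, g \in msupp (m << s >> << t >>) -> (deg g <= deg s + deg t)%N) ->
  (forall s p, p \in msupp (D << s >>) -> (deg p.1 + deg p.2 <= deg s)%N) ->
  is_filtered m D F.
Proof.
move=> FE ml mr Dl dm dD; split.
  move=> p q x y /FE xp /FE yq; apply/FE => g.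
  rewrite (linear_lin_ext x (ml y)) => /msupp_lin_ext[s sx].
  rewrite (linear_lin_ext y (mr _)) => /msupp_lin_ext[t ty] /dm gst.
  by apply: leq_trans gst _; apply: leq_add; [exact: xp|exact: yq].
move=> n x /FE xn.
have dDx p : p \in msupp (D x) -> (deg p.1 + deg p.2 <= n)%N.
  rewrite (linear_lin_ext x Dl) => /msupp_lin_ext[s /xn sn] /dD ps.
  exact: leq_trans ps sn.
(* Terms are sorted by the exact degree [i] of the left factor; the right factor then has degree at
   most [n - i]. *)
exists (fun i => \sum_(p <- msupp (D x) | deg p.1 == i) (D x)@_p *: << p >>).
  move=> i le_in; exists [seq ((D x)@_p *: << p.1 >>, << p.2 >>) |
                        p <- msupp (D x) & deg p.1 == i].
    move=> _ /mapP[p + ->] /=; rewrite mem_filter => /andP[/eqP pi /dDx pn].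
    split; apply/FE => k /=.
      move=> /(fsubsetP (msuppZ_le _ _)) /(fsubsetP (@msuppU_le _ _ _ _)).
      by rewrite inE => /eqP ->; rewrite pi.
    by move=> /(fsubsetP (@msuppU_le _ _ _ _)); rewrite inE => /eqP ->; lia.
  rewrite big_map big_filter; apply: eq_bigr => -[a b] _ /=.
  by rewrite (linearP_scale (@tensPl _ _ _ _)) tensU.
rewrite {1}[D x]malg_sum.
under [RHS]eq_bigr do rewrite big_mkcond /=.
rewrite exchange_big /= big_seq [RHS]big_seq; apply: eq_bigr => p /dDx pn.
have kn : (deg p.1 < n.+1)%N by rewrite ltnS (leq_trans (leq_addr _ _) pn).
rewrite (bigD1 (Ordinal kn)) //= eqxx big1 ?addr0 // => i.
by rewrite -val_eqE /= eq_sym => /negbTE ->.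
Qed.

Lemma one_dimensional_deg0 (F : H -> Prop) (e : K) :
  (forall x, F x <-> basis_span (fun s => (deg s <= 0)%N) x) ->
  (forall s, deg s = 0%N <-> s = e) -> one_dimensional F.
Proof.
move=> FE dE; exists << e >>; first by rewrite monalgU_eq0 oner_eq0.
move=> x; split=> [/FE x0|[c ->]].
  exists x@_e; apply/malgP => k; rewrite mcoeffZ mcoeffU.
  case: eqP => [<-|ek]; first by rewrite mulr1.
  rewrite mulr0; apply/mcoeff_outdom/negP => /x0; rewrite leqn0 => /eqP /dE ke.
  exact: ek.
apply/FE => k /(fsubsetP (msuppZ_le _ _)) /(fsubsetP (@msuppU_le _ _ _ _)).
by rewrite inE => /eqP ->; rewrite leqn0; apply/eqP/dE.
Qed.

End Filtration.

(** * Splittings of words *)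

Section Words.

(* In the word of an interval partition, None marks a point outside the ground
   set, Some true the first point of a block and Some false any other one. *)
Definition join (x y : option bool) : option bool :=
  match x, y with
  | Some b, Some c => Some (b && c)
  | None, _ => y
  | _, None => x
  end.

Definition joins (w w' : seq (option bool)) : seq (option bool) :=
  [seq join l.1 l.2 | l <- zip w w'].

(* The boolean [p] tells whether the previous point lies in the ground set. *)
Definition allowed (p : bool) (l : option bool) : bool := (l == Some false) ==> p.

(** Words of interval partitions are read from state [false], since the point 0 is in no ground
    set. *)
Fixpoint valid (p : bool) (w : seq (option bool)) : bool :=
  if w is l :: w' then allowed p l && valid (isSome l) w' else true.

Definition del (w : seq (option bool)) : seq bool := pmap id w.
#[global] Arguments del : simpl never.

Definition ocons (l : option bool) (v : seq bool) : seq bool :=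
  if l is Some b then b :: v else v.

Lemma del_cons l w : del (l :: w) = ocons l (del w).
Proof. by case: l. Qed.

(** These turn out to be the words of standardized partitions: the first point must open a block.
    The default [true] admits the empty word, which codes [e_st]. *)
Definition good (v : seq bool) : bool := head true v.

Lemma valid_good w : valid false w -> good (del w).
Proof. by elim: w => //= -[[]|] w IH //= /IH. Qed.

Definition split_letters (p p' b : bool) : pred (option bool * option bool) :=
  fun l => [&& allowed p l.1, allowed p' l.2 & join l.1 l.2 == Some b].

Fixpoint splits (p p' : bool) (s : seq bool) :
    seq (seq (option bool) * seq (option bool)) :=
  if s is b :: s' then
    [seq (l.1 :: w.1, l.2 :: w.2)
      | l <- enum (split_letters p p' b), w <- splits (isSome l.1) (isSome l.2) s']
  else [:: ([::], [::])].

(** Links the recursive enumeration, on which the inductions run, to the global description by which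
    gluings are counted. *)
Lemma mem_splits p p' s w :
  (w \in splits p p' s) =
  [&& valid p w.1, valid p' w.2, size w.1 == size w.2
    & joins w.1 w.2 == map Some s].
Proof.
elim: s p p' w => [|b s IH] p p' [[|x w] [|y w']] //=; rewrite ?andbF //.
- by apply/allpairsPdep => -[? [? [_ _ /pair_equal_spec[]]]].
- by apply/allpairsPdep => -[? [? [_ _ /pair_equal_spec[]]]].
- by apply/allpairsPdep => -[? [? [_ _ /pair_equal_spec[]]]].
apply/allpairsPdep/idP => [[l [v]]|].
  move=> [+ + [-> -> -> ->]]; rewrite mem_enum IH eqSS /joins /=.
  move=> /and3P[/= h1 h2 /eqP h3] /and4P[h4 h5 h6 /eqP h7].
  by rewrite h1 h2 h3 h4 h5 h6 -h7 !eqxx.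
rewrite eqSS => /and4P[/andP[h1 h4] /andP[h2 h5] h6 /eqP[h3 h7]].
exists (x, y), (w, w'); split=> //=; first by rewrite mem_enum; apply/and3P; rewrite /= h3.
by rewrite IH /= h4 h5 h6 /joins h7 eqxx.
Qed.

Lemma splits_uniq p p' s : uniq (splits p p' s).
Proof.
elim: s p p' => [//|b s IH] p p' /=; apply: allpairs_uniq_dep => //.
- exact: enum_uniq.
- move=> [[x y] [w w']] [[x1 y1] [w1 w1']] _ _ /= [-> -> -> ->] //.
Qed.

Section SplitSum.
Variable V : nmodType.
Implicit Types (F : seq bool -> seq bool -> V) (G : seq bool -> seq bool -> seq bool -> V).

(** The coproduct of a word, evaluated in an arbitrary [F] so that iterated coproducts are nested
    sums of this kind. *)
Definition split_sum (p p' : bool) (s : seq bool) F : V :=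
  \sum_(w <- splits p p' s) F (del w.1) (del w.2).

Lemma split_sum0 p p' F : split_sum p p' [::] F = F [::] [::].
Proof. by rewrite /split_sum big_seq1. Qed.

Lemma split_sum_cons p p' b s F :
  split_sum p p' (b :: s) F =
  \sum_(l | split_letters p p' b l)
    split_sum (isSome l.1) (isSome l.2) s
      (fun v v' => F (ocons l.1 v) (ocons l.2 v')).
Proof.
rewrite /split_sum /= big_allpairs_dep big_enum /=.
by apply: eq_bigr => l _; apply: eq_bigr => w _; rewrite !del_cons.
Qed.

Lemma eq_split_sum p p' s F F' : (forall v v', F v v' = F' v v') ->
  split_sum p p' s F = split_sum p p' s F'.
Proof. by move=> FF'; apply: eq_bigr => w _; exact: FF'. Qed.

Lemma split_sum_sum p p' s (I : finType) (P : pred I)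
    (G : I -> seq bool -> seq bool -> V) :
  split_sum p p' s (fun v v' => \sum_(i | P i) G i v v') =
  \sum_(i | P i) split_sum p p' s (G i).
Proof. exact: exchange_big. Qed.

(** Cocommutativity, from the commutativity of [join]. *)
Lemma split_sum_swap p p' s F :
  split_sum p p' s F = split_sum p' p s (fun v v' => F v' v).
Proof.
elim: s p p' F => [|b s IH] p p' F; first by rewrite !split_sum0.
rewrite !split_sum_cons (reindex_inj (can_inj (@swap_pairK _ _))) /=.
apply: eq_big => [[x y]|[x y] _]; last exact: IH.
rewrite /split_letters /= andbCA; congr [&& _, _ & _ == _].
by case: x y => [x|] [y|] //=; rewrite andbC.
Qed.

(** * Threefold splittings and coassociativity *)

Definition split3_letters (p1 p2 p3 b : bool) :
    pred ((option bool * option bool) * option bool) :=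
  fun l => [&& allowed p1 l.1.1, allowed p2 l.1.2, allowed p3 l.2
             & join (join l.1.1 l.1.2) l.2 == Some b].

(** The common value of both iterated coproducts. Letter triples are summed at each step, without
    listing triples of words. *)
Fixpoint split3_sum (p1 p2 p3 : bool) (s : seq bool)
    (F : seq bool -> seq bool -> seq bool -> V) : V :=
  if s is b :: s' then
    \sum_(l | split3_letters p1 p2 p3 b l)
      split3_sum (isSome l.1.1) (isSome l.1.2) (isSome l.2) s'
        (fun v1 v2 v3 => F (ocons l.1.1 v1) (ocons l.1.2 v2) (ocons l.2 v3))
  else F [::] [::] [::].

(* If the previous point is absent from the split word v, the next letter of v
   is None or Some true, so the states p1 and p2 do not matter. *)
Lemma split_sum_assoc_l p p1 p2 p3 s G :
  split_sum p p3 s (fun v v3 => split_sum p1 p2 v (fun v1 v2 => G v1 v2 v3)) =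
  split3_sum (p && p1) (p && p2) p3 s G.
Proof.
elim: s p p1 p2 p3 G => [|b s IH] p p1 p2 p3 G; first by rewrite !split_sum0.
rewrite split_sum_cons /=.
(* Letter triples are grouped by the pair that they induce in the outer splitting. *)
rewrite [RHS](partition_big (fun r => (join r.1.1 r.1.2, r.2))
                            (split_letters p p3 b)) /=; last first.
  move=> [[l1 l2] l3] /and4P[/= h1 h2 h3 h4].
  apply/and3P; split=> //=; move: h1 h2; rewrite /allowed.
  by case: l1 l2 {h4} => [[]|] [[]|] //=; case: p.
apply: eq_bigr => -[l l3] /and3P[/= hl h3 hj].
transitivity (\sum_(q | [&& allowed (p && p1) q.1, allowed (p && p2) q.2
                          & join q.1 q.2 == l])
  split3_sum (isSome q.1) (isSome q.2) (isSome l3) s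
   (fun v1 v2 v3 => G (ocons q.1 v1) (ocons q.2 v2) (ocons l3 v3))); last first.
  rewrite [RHS](reindex (fun q : option bool * option bool => (q, l3))) /=; last first.
    exists fst => // -[[l1 l2] l4]; rewrite inE /= xpair_eqE.
    by move=> /andP[_ /andP[_ /eqP ->]].
  apply: eq_bigl => -[l1 l2]; rewrite /split3_letters /= xpair_eqE eqxx andbT.
  case: (altP (join l1 l2 =P l)) => [->|]; last by rewrite !andbF.
  by rewrite h3 hj !andbT.
(* For an outer letter [None] the inner splitting does not advance and keeps [p1], [p2], but the
   outer state becomes [false] and masks them. For [Some c] the inner splitting reads one letter. *)
case: l hl hj => [c|] hl hj /=; last first.
  rewrite (big_pred1 (None, None)) /=; last by move=> [[[]|] [[]|]]; rewrite /= ?andbF.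
  by rewrite IH.
under eq_split_sum do rewrite split_sum_cons.
rewrite split_sum_sum; apply: eq_big => [[l1 l2]|[l1 l2] _]; last by rewrite IH.
rewrite /split_letters /=; move: hl; rewrite /allowed.
by case: p p1 p2 c {hj} => [] [] [] [] //=; case: l1 l2 => [[]|] [[]|].
Qed.

Lemma split3_sum_rot p1 p2 p3 s G :
  split3_sum p1 p2 p3 s G = split3_sum p2 p3 p1 s (fun v2 v3 v1 => G v1 v2 v3).
Proof.
elim: s p1 p2 p3 G => [//|b s IH] p1 p2 p3 G /=.
rewrite (reindex (fun r : (option bool * option bool) * option bool => ((r.2, r.1.1), r.1.2))) /=;
  last first.
  by exists (fun r => ((r.1.2, r.2), r.1.1)) => [] [[l1 l2] l3].
apply: eq_big => [[[l1 l2] l3]|[[l1 l2] l3] _]; last exact: IH.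
rewrite /split3_letters /= andbC -!andbA; do 2!congr (_ && _).
rewrite andbC; congr (_ && (_ == _)).
by case: l1 l2 l3 => [[]|] [[]|] [[]|].
Qed.

(** Swapping the outer factors gives the other bracketing, and a rotation restores the order of the
    three words. *)
Lemma split_sum_assoc_r p p1 p2 p3 s G :
  split_sum p1 p s (fun v1 v => split_sum p2 p3 v (G v1)) =
  split3_sum p1 (p && p2) (p && p3) s G.
Proof.
rewrite split_sum_swap (split_sum_assoc_l _ _ _ _ _ (fun v2 v3 v1 => G v1 v2 v3)).
by rewrite -split3_sum_rot.
Qed.

Lemma split_sum_coassoc s G :
  split_sum false false s
    (fun v v3 => split_sum false false v (fun v1 v2 => G v1 v2 v3)) =
  split_sum false false s (fun v1 v => split_sum false false v (G v1)).
Proof. by rewrite split_sum_assoc_l split_sum_assoc_r. Qed.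

(** A first letter [true] forbids [Some false] on both sides, and only [Some false] consults the
    states. *)
Lemma split_sum_good p p' s F : good s ->
  split_sum p p' s F = split_sum false false s F.
Proof.
case: s => [|[] s] // _; rewrite !split_sum_cons.
by apply: eq_bigl => -[[[]|] [[]|]]; rewrite /split_letters /= ?andbF.
Qed.

(** Whatever states are reached at the end of [s], they can be reset to [false] before the good word
    [t]. *)
Lemma split_sum_cat p p' s t F : good t ->
  split_sum p p' (s ++ t) F =
  split_sum p p' s (fun v v' =>
    split_sum false false t (fun w w' => F (v ++ w) (v' ++ w'))).
Proof.
move=> gt; elim: s p p' F => [|b s IH] p p' F.
  by rewrite split_sum0 /= split_sum_good.
rewrite cat_cons !split_sum_cons; apply: eq_bigr => -[l l'] _.
by rewrite IH; case: l l' => [l|] [l'|].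
Qed.

(** An empty left word forces [None] throughout on the left, hence [s] itself on the right. The
    hypothesis makes the first right letter allowed; after it the right state is [true]. *)
Lemma split_sum_counit_l p p' s (G : seq bool -> V) : p' || good s ->
  split_sum p p' s (fun v v' => if v == [::] then G v' else 0) = G s.
Proof.
elim: s p p' G => [|b s IH] p p' G hs; first by rewrite split_sum0.
rewrite split_sum_cons (bigD1 (None, Some b)) /=; last first.
  by rewrite /split_letters /= eqxx andbT; case: b p' hs => [] [].
rewrite IH // big1 ?addr0 // => -[[c|] l'] /andP[/and3P[/= _ _ hj] nl].
  by rewrite /split_sum big1.
by case/negP: nl; rewrite xpair_eqE.
Qed.

Lemma split_sum_counit_r s (G : seq bool -> V) : good s ->
  split_sum false false s (fun v v' => if v' == [::] then G v else 0) = G s.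
Proof. by move=> gs; rewrite split_sum_swap split_sum_counit_l. Qed.

End SplitSum.
End Words.

(** * Words of interval partitions *)

Section Coding.
Local Open Scope nat_scope.

Section Blocks.
Variable I : IP.

Lemma ip_uniq E F x : E \in blocks I -> F \in blocks I -> x \in E -> x \in F -> E = F.
Proof.
move=> EI FI xE xF; have /is_ipP[_ dis] := valP I.
apply/eqP/negPn/negP => /(dis _ _ EI FI)/fdisjointP/(_ _ xE).
by rewrite xF.
Qed.

Lemma ip_block_ivl E : E \in blocks I -> exists a b, 0 < a <= b /\ E = ivl a b.
Proof. by move=> EI; have /is_ipP[/(_ _ EI)/is_intervalP] := valP I. Qed.

Lemma ip_convex E x y z : E \in blocks I -> x \in E -> y \in E -> x <= z <= y -> z \in E.
Proof. by move=> /ip_block_ivl[a [b [_ ->]]]; rewrite !in_ivl; lia. Qed.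

Lemma ip_pos E x : E \in blocks I -> x \in E -> 0 < x.
Proof. by move=> /ip_block_ivl[a [b [ab ->]]]; rewrite in_ivl; lia. Qed.

Lemma ground_pos x : x \in ground I -> 0 < x.
Proof. by case/in_fcover => E; apply: ip_pos. Qed.

End Blocks.

Definition linked (P : {fset {fset nat}}) (i : nat) : bool :=
  [exists E : P, (i.-1 \in val E) && (i \in val E)].

Lemma linkedP (P : {fset {fset nat}}) i :
  reflect (exists2 E, E \in P & i.-1 \in E /\ i \in E) (linked P i).
Proof.
apply: (iffP existsP) => [[E /andP[h1 h2]]|[E EP [h1 h2]]].
  by exists (val E) => //; exact: valP.
by exists [` EP]; rewrite /= h1.
Qed.

(** Defined for any set of sets, so that it applies to [blocks_of] before that is known to be an
    interval partition. *)
Definition letter (P : {fset {fset nat}}) (i : nat) : option bool :=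
  if i \in fcover P then Some (~~ linked P i) else None.

Lemma letter_None (I : IP) i : letter I i = None <-> i \notin ground I.
Proof. by rewrite /letter -/(ground I); case: (i \in ground I). Qed.

Lemma letter_false (I : IP) i :
  letter I i.+1 = Some false <-> exists2 E, E \in blocks I & i \in E /\ i.+1 \in E.
Proof.
split=> [|h].
  by rewrite /letter; case: ifP => // _ [/negbFE/linkedP].
rewrite /letter (introT (linkedP I i.+1) h) ifT //.
by case: h => E EI [_ iE]; apply/in_fcover; exists E.
Qed.

Lemma letter0 (I : IP) : letter I 0 = None.
Proof. by apply/letter_None/negP => /ground_pos. Qed.

Definition is_block (L : nat -> option bool) (a b : nat) : bool :=
  [&& a <= b, L a == Some true, all (fun i => L i == Some false) (iota a.+1 (b - a))
    & L b.+1 != Some false].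

Lemma is_blockP L a b :
  reflect [/\ a <= b, L a = Some true, forall i, a < i <= b -> L i = Some false
            & L b.+1 <> Some false] (is_block L a b).
Proof.
apply: (iffP and4P) => -[h1 h2 h3 h4]; split=> //.
- exact/eqP.
- by move=> i hi; apply/eqP; move/allP: h3; apply; rewrite mem_iota; lia.
- exact/eqP.
- exact/eqP.
- by apply/allP => i; rewrite mem_iota => hi; apply/eqP; apply: h3; lia.
- exact/eqP.
Qed.

(** If one run started inside the other, its first letter would be both [Some true] and
    [Some false]; if one stopped earlier, it would be followed by [Some false]. *)
Lemma is_block_inj L a b a' b' x : is_block L a b -> is_block L a' b' ->
  a <= x <= b -> a' <= x <= b' -> a = a' /\ b = b'.
Proof.
move=> /is_blockP[h1 h2 h3 h4] /is_blockP[h1' h2' h3' h4'] xab xab'.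
have aa' : a = a'.
  case: (ltngtP a a') => // h.
    by have := h3 a'; rewrite h2' => /(_ _) => H; have // := H ltac:(lia).
  by have := h3' a; rewrite h2 => /(_ _) => H; have // := H ltac:(lia).
split=> //; case: (ltngtP b b') => // h.
  by case: h4; apply: h3'; lia.
by case: h4'; apply: h3; lia.
Qed.

(** Blocks are recovered from the letters alone, which makes the coding injective. *)
Lemma mem_blocks (I : IP) E :
  E \in blocks I <-> exists a b, is_block (letter I) a b /\ E = ivl a b.
Proof.
have fwd F : F \in blocks I -> exists a b, is_block (letter I) a b /\ F = ivl a b.
  move=> FI; have [a [b [ab Fab]]] := ip_block_ivl FI.
  have inF x : (x \in F) = (a <= x <= b) by rewrite Fab in_ivl.
  exists a, b; split=> //; apply/is_blockP; split; first by lia.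
  - have aF : a \in F by rewrite inF; lia.
    rewrite /letter ifT; last by apply/in_fcover; exists F.
    congr Some; apply/negP => /linkedP[G GI [h1 h2]].
    by move: h1; rewrite (ip_uniq GI FI h2 aF) inF; lia.
  - move=> [//|i] hi; apply/letter_false; exists F => //; rewrite !inF; lia.
  - move=> /letter_false[G GI [h1 h2]].
    have bF : b \in F by rewrite inF; lia.
    by move: h2; rewrite (ip_uniq GI FI h1 bF) inF; lia.
split=> [/fwd //|[a [b [hab ->]]]].
have /is_blockP[h1 h2 _ _] := hab.
have /in_fcover[F FI aF] : a \in fcover I by move: h2; rewrite /letter; case: ifP.
have [a' [b' [hab' Fab]]] := fwd _ FI.
have [] := is_block_inj (x := a) hab hab'; first by lia.
  by move: aF; rewrite Fab in_ivl.
by move=> -> ->; rewrite -Fab.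
Qed.

Lemma letter_inj (I J : IP) : letter I =1 letter J -> I = J.
Proof.
move=> IJ; apply: val_inj; apply/fsetP => E; apply/idP/idP => /mem_blocks[a [b [hab ->]]];
  apply/mem_blocks; exists a, b; split=> //;
  move/is_blockP: hab => [h1 h2 h3 h4]; apply/is_blockP; split=> //.
- by rewrite -IJ.
- by move=> i hi; rewrite -IJ h3.
- by rewrite -IJ.
- by rewrite IJ.
- by move=> i hi; rewrite IJ h3.
- by rewrite IJ.
Qed.

(** The counterpart of [valid false] for letters indexed by all of [nat]. *)
Definition letters_ok (n : nat) (L : nat -> option bool) : Prop :=
  [/\ L 0 = None, forall i, n < i -> L i = None
    & forall i, L i.+1 = Some false -> L i <> None].

Definition blocks_of (n : nat) (L : nat -> option bool) : {fset {fset nat}} :=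
  [fset E in [seq ivl p.1 p.2 | p <- [seq (a, b) | a <- iota 1 n, b <- iota 1 n]
                             & is_block L p.1 p.2]].

Section Decode.
Variables (n : nat) (L : nat -> option bool).
Hypothesis Lok : letters_ok n L.

(** Shows that the search range of [blocks_of] misses no run. *)
Lemma is_block_bounds a b : is_block L a b -> 0 < a <= b /\ b <= n.
Proof.
have [L0 Ln _] := Lok; move=> /is_blockP[h1 h2 h3 h4].
have a0 : 0 < a by case: (a) h2 => //; rewrite L0.
split; first by rewrite a0.
case: (leqP b n) => // nb; case: (ltngtP a b) h1 => // [ab|ab] _.
  by have := h3 b; rewrite Ln // => H; have // := H ltac:(lia).
by move: h2; rewrite ab Ln.
Qed.

Lemma mem_blocks_of E :
  E \in blocks_of n L <-> exists a b, is_block L a b /\ E = ivl a b.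
Proof.
rewrite !inE /=; split.
  move=> /mapP[[a b]]; rewrite mem_filter => /andP[h _] ->.
  by exists a, b.
move=> [a [b [hab ->]]]; apply/mapP; exists (a, b) => //.
rewrite mem_filter hab /=; apply/allpairsP; exists (a, b).
have := is_block_bounds hab; rewrite !mem_iota /=; split=> //; lia.
Qed.

(** Going left from [i] through [Some false] ends at a [Some true], because the letter at 0 is
    [None]; going right ends because letters vanish beyond [n]. *)
Lemma block_exists i : L i <> None -> exists a b, is_block L a b /\ a <= i <= b.
Proof.
have [L0 Ln Lf] := Lok => Li.
have [a [ai La ha]] : exists a, [/\ a <= i, L a = Some true
    & forall j, a < j <= i -> L j = Some false].
  elim: i Li => [|i IH] Li; first by rewrite L0 in Li.
  case E : (L i.+1) Li => [[]|] // _.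
    by exists i.+1; split=> // j; lia.
  have [a [ai La ha]] := IH (Lf _ E); exists a; split=> //; first by lia.
  move=> j hj; case: (ltngtP j i.+1) => [ji|ji|-> //]; last by lia.
  by apply: ha; lia.
have [b [ib Lb hb]] : exists b, [/\ i <= b, L b.+1 <> Some false
    & forall j, i < j <= b -> L j = Some false].
  have : exists k, L (i + k).+1 != Some false.
    (* Offset [n] leads past the point [n], where every letter is [None]. *)
    by exists n; rewrite Ln //; lia.
  move=> /ex_minnP[k hk kmin]; exists (i + k); split; [by lia|exact/eqP|].
  move=> j hj; apply/eqP/negPn/negP => hn.
  have := kmin (j - i).-1; have -> : (i + (j - i).-1).+1 = j by lia.
  by move=> /(_ hn); lia.
exists a, b; split; last by lia.
apply/is_blockP; split=> //; first by lia.
by move=> j hj; case: (leqP j i) => ji; [apply: ha|apply: hb]; lia.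
Qed.

Lemma blocks_of_ip : is_ip (blocks_of n L).
Proof.
apply/is_ipP; split.
  move=> _ /mem_blocks_of[a [b [/is_block_bounds[ab _] ->]]].
  by apply/is_intervalP; exists a, b.
move=> _ _ /mem_blocks_of[a [b [hab ->]]] /mem_blocks_of[a' [b' [hab' ->]]] neq.
apply/fdisjointP => x; rewrite in_ivl => xab; apply/negP; rewrite in_ivl => xab'.
have [aa bb] := is_block_inj hab hab' xab xab'.
by rewrite aa bb eqxx in neq.
Qed.

Lemma letter_blocks_of i : letter (blocks_of n L) i = L i.
Proof.
have [L0 Ln Lf] := Lok.
case E : (L i) => [c|]; last first.
  rewrite /letter ifF //; apply/negP => /in_fcover[_ /mem_blocks_of[a [b [hab ->]]]].
  rewrite in_ivl; move/is_blockP: hab => [h1 h2 h3 _] hi.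
  case: (ltngtP a i) => [ai|//|ai]; [|by lia|by rewrite ai E in h2].
  by have := h3 i; rewrite E => H; have // := H ltac:(lia).
have [|a [b [hab ib]]] := @block_exists i; first by rewrite E.
have Emem : ivl a b \in blocks_of n L by apply/mem_blocks_of; exists a, b.
rewrite /letter ifT; last by apply/in_fcover; exists (ivl a b); rewrite ?in_ivl.
congr Some; have /is_blockP[h1 h2 h3 _] := hab.
case: c E => E.
  apply/negP => /linkedP[_ /mem_blocks_of[a' [b' [hab' ->]]] []].
  rewrite !in_ivl => hi1 hi2.
  have [aa bb] := is_block_inj hab hab' ib hi2.
  have i0 : i <> 0 by move=> i0; rewrite i0 L0 in E.
  by have := h3 i; rewrite E => H; have // := H ltac:(lia).
apply/negbTE; rewrite negbK; apply/linkedP; exists (ivl a b) => //.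
have ai : a <> i by move=> ai; rewrite ai E in h2.
by rewrite !in_ivl; lia.
Qed.

End Decode.

Definition encode (n : nat) (I : IP) : seq (option bool) :=
  [seq letter I i | i <- iota 1 n].

(** Letters are numbered from 1 like the points; the added head is the letter of the absent point
    0. *)
Definition word_letter (w : seq (option bool)) (i : nat) : option bool :=
  nth None (None :: w) i.

(** The default of [insubd] makes this total; it is not reached on words with [valid false w]. *)
Definition decode (w : seq (option bool)) : IP :=
  insubd (ip e_st) (blocks_of (size w) (word_letter w)).

Lemma size_encode n I : size (encode n I) = n.
Proof. by rewrite size_map size_iota. Qed.

Lemma nth_encode n (I : IP) i : 0 < i <= n -> nth None (encode n I) i.-1 = letter I i.
Proof.
move=> hi; rewrite (nth_map 0) ?size_iota; last by lia.
by rewrite nth_iota; [congr letter|]; lia.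
Qed.

Lemma valid_letters_ok w : valid false w -> letters_ok (size w) (word_letter w).
Proof.
move=> vw; split=> // [[//|i] hi|i]; first by rewrite /word_letter nth_default.
(* The state [p] stands for presence of the point before [u], which for the whole word is the point
   0. *)
rewrite /word_letter; suff H p u j : valid p u -> nth None u j = Some false ->
    if j is j'.+1 then nth None u j' != None else p.
  by move=> /(H _ _ _ vw); case: i => [//|i] /eqP.
elim: u j p => [|l u IH] [|j] p //= /andP[al vu].
  by move=> El; move: al; rewrite El.
by move=> /(IH _ _ vu); case: j => [|j] //=; case: (l).
Qed.

Lemma valid_encode n I : valid false (encode n I).
Proof.
rewrite /encode; suff H m : valid (m \in ground I) [seq letter I i | i <- iota m.+1 n].
  have := H 0; case: (boolP (0 \in ground I)) => //.
  by move=> /ground_pos.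
elim: n m => [//|n IH] m /=; apply/andP; split; last first.
  by rewrite {1}/letter -/(ground I); case: (boolP (m.+1 \in _)) (IH m.+1).
apply/implyP => /eqP /letter_false[E EI [mE _]].
by apply/in_fcover; exists E.
Qed.

Lemma letter_decode w i : valid false w -> letter (decode w) i = word_letter w i.
Proof.
move=> /valid_letters_ok ok; rewrite /decode insubdK ?letter_blocks_of //.
exact: blocks_of_ip.
Qed.

Lemma encode_decode w : valid false w -> encode (size w) (decode w) = w.
Proof.
move=> vw; apply: (@eq_from_nth _ None); rewrite ?size_encode // => i hi.
have := @nth_encode (size w) (decode w) i.+1; rewrite /= => ->; last by lia.
by rewrite letter_decode.
Qed.

Lemma ground_decode w : valid false w -> ground (decode w) `<=` ivl 1 (size w).
Proof.
move=> vw; apply/fsubsetP => i ig; rewrite in_ivl; apply/negPn/negP => hi.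
suff : letter (decode w) i = None by move=> /letter_None; rewrite ig.
rewrite letter_decode // /word_letter; case: i hi {ig} => [//|i] hi.
by rewrite /= nth_default //; lia.
Qed.

Lemma letter_gt n (I : IP) i : ground I `<=` ivl 1 n -> n < i -> letter I i = None.
Proof.
move=> /fsubsetP In ni; apply/letter_None/negP => /In; rewrite in_ivl; lia.
Qed.

Lemma encode_letterP n (I J : IP) : ground I `<=` ivl 1 n -> ground J `<=` ivl 1 n ->
  encode n I = encode n J <-> I = J.
Proof.
move=> In Jn; split=> [eIJ|-> //]; apply: letter_inj => -[|i].
  by rewrite !letter0.
case: (leqP i.+1 n) => hi; last by rewrite !(@letter_gt n).
by rewrite -(@nth_encode n) ?eIJ ?nth_encode.
Qed.

Lemma decode_encode n I : ground I `<=` ivl 1 n -> decode (encode n I) = I.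
Proof.
have vI := valid_encode n I.
move=> In; apply/(@encode_letterP n) => //.
  by rewrite -{2}(size_encode n I); exact: ground_decode.
by rewrite -{1}(size_encode n I) encode_decode.
Qed.

(** * Gluing as letterwise join *)

Section Glue.
Variables I J K : IP.
Hypothesis KE : forall i, letter K i = join (letter I i) (letter J i).

Let B := blocks I `|` blocks J.

Lemma join_ground i : (i \in ground K) = (i \in ground I) || (i \in ground J).
Proof.
have := KE i; rewrite /letter -!/(ground _).
by case: (i \in ground I) (i \in ground J) (i \in ground K) => [] [] [].
Qed.

(** A join is [Some false] exactly when one of its arguments is. *)
Lemma join_linked i : (exists2 E, E \in blocks K & i \in E /\ i.+1 \in E) <->
  (exists2 X, X \in B & i \in X /\ i.+1 \in X).
Proof.
rewrite -letter_false KE; split.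
  case EI : (letter I i.+1) => [[]|]; case EJ : (letter J i.+1) => [[]|] //= _;
    by [have /letter_false[X XI h] := EI; exists X => //; rewrite in_fsetU XI
       |have /letter_false[X XI h] := EJ; exists X => //; rewrite in_fsetU XI orbT].
move=> [X + h]; rewrite in_fsetU => /orP[XI|XJ].
  have -> : letter I i.+1 = Some false by apply/letter_false; exists X.
  by case: letter.
have -> : letter J i.+1 = Some false by apply/letter_false; exists X.
by case: letter => //= b; rewrite andbF.
Qed.

Lemma block_union_ivl X : X \in B -> exists a b, 0 < a <= b /\ X = ivl a b.
Proof. by rewrite in_fsetU => /orP[] /ip_block_ivl. Qed.

(** Consecutive points of [X] are linked in [K], so walking along [X] never leaves the block of its
    first point. *)
Lemma block_union_sub X : X \in B -> exists2 E, E \in blocks K & X `<=` E.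
Proof.
move=> XB; have [a [b [ab Xab]]] := block_union_ivl XB.
have /in_fcover[E EK aE] : a \in ground K.
  rewrite join_ground; move: XB; rewrite in_fsetU => /orP[] XI; apply/orP; [left|right];
    by apply/in_fcover; exists X => //; rewrite Xab in_ivl; lia.
exists E => //; apply/fsubsetP => x; rewrite Xab in_ivl.
elim: x => [|x IH] hx; first by lia.
case: (ltngtP a x.+1) => [ax|ax|<- //]; last by lia.
have xE : x \in E by apply: IH; lia.
have [E' E'K [xE' xE1]] : exists2 E, E \in blocks K & x \in E /\ x.+1 \in E.
  by apply/join_linked; exists X => //; rewrite Xab !in_ivl; lia.
by rewrite (ip_uniq EK E'K xE xE').
Qed.

Let meets := [rel E F : B | val E `&` val F != fset0].

Lemma meetsP (X Y : B) : reflect (exists2 x, x \in val X & x \in val Y) (meets X Y).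
Proof.
apply: (iffP (fset0Pn _)) => -[x]; first by rewrite in_fsetI => /andP[]; exists x.
by move=> h1 h2; exists x; rewrite in_fsetI h1.
Qed.

Lemma meets_sym : connect_sym meets.
Proof. by apply: sym_connect_sym => X Y; rewrite /= fsetIC. Qed.

(** Inclusion in [E] passes between sets that meet, since blocks of [K] are disjoint and each set of
    [B] lies in one of them. *)
Lemma connect_sub_block (X Y : B) E : E \in blocks K -> connect meets X Y ->
  val X `<=` E -> val Y `<=` E.
Proof.
move=> EK XY; have H (X' Y' : B) : meets X' Y' -> val X' `<=` E -> val Y' `<=` E.
  move=> /meetsP[x xX xY] /fsubsetP/(_ _ xX) xE.
  have [E' E'K YE] := block_union_sub (valP Y').
  by rewrite (ip_uniq EK E'K xE (fsubsetP YE _ xY)).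
have cl : closed meets [pred Z : B | val Z `<=` E].
  move=> X' Y' XY'; rewrite !inE; apply/idP/idP; apply: H => //.
  by move: XY'; rewrite /= fsetIC.
by have := closed_connect cl XY; rewrite !inE => ->.
Qed.

(** On the way from [x] to [y] each unit step is made inside some set of [B], and the sets of
    successive steps share a point. *)
Lemma connect_block_le (X Y : B) E x y : E \in blocks K -> x \in E -> y \in E ->
  x \in val X -> y \in val Y -> x <= y -> connect meets X Y.
Proof.
move=> EK xE yE xX + /subnKC yx; rewrite -{}yx in yE *.
elim: (y - x) yE Y => [|k IH] yE Y.
  by rewrite addn0 => xY; apply/connect1/meetsP; exists x.
rewrite addnS in yE *; move=> kY.
have kE : x + k \in E by apply: (ip_convex EK xE yE); lia.
have [Z ZB [kZ kZ1]] : exists2 X, X \in B & x + k \in X /\ (x + k).+1 \in X.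
  by apply/join_linked; exists E.
apply: connect_trans (IH kE [` ZB] kZ) _.
by apply/connect1/meetsP; exists (x + k).+1.
Qed.

Lemma glue_class (T : B) E : E \in blocks K -> val T `<=` E ->
  \big[fsetU/fset0]_(X : B | connect meets X T) val X = E.
Proof.
move=> EK TE; apply/fsetP => x; apply/bigfcupP/idP => [[X /andP[_ XT] xX]|xE].
  move: XT; rewrite meets_sym => /(connect_sub_block EK)/(_ TE)/fsubsetP.
  exact.
have [a [b [ab Tab]]] := block_union_ivl (valP T).
have aT : a \in val T by rewrite Tab in_ivl; lia.
have aE := fsubsetP TE _ aT.
have [X XB xX] : exists2 X, X \in B & x \in X.
  have : x \in ground K by apply/in_fcover; exists E.
  rewrite join_ground => /orP[] /in_fcover[X XI xX]; exists X => //;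
    by rewrite in_fsetU XI ?orbT.
exists [` XB] => //; rewrite mem_index_enum /=.
case: (leqP x a) => xa; first exact: (connect_block_le EK xE aE).
by rewrite meets_sym; apply: (connect_block_le EK aE xE) => //; lia.
Qed.

Lemma glue_join : glue I J = blocks K.
Proof.
apply/fsetP => E; apply/imfsetP/idP => [[T _ ->]|EK].
  have [F FK TF] := block_union_sub (valP T).
  by rewrite (glue_class FK TF).
have [a [b [ab Eab]]] := ip_block_ivl EK.
have aE : a \in E by rewrite Eab in_ivl; lia.
have [X XB aX] : exists2 X, X \in B & a \in X.
  have : a \in ground K by apply/in_fcover; exists E.
  rewrite join_ground => /orP[] /in_fcover[X XI aX]; exists X => //;
    by rewrite in_fsetU XI ?orbT.
exists [` XB] => //; rewrite (glue_class EK) //=.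
have [F FK XF] := block_union_sub XB.
by rewrite (ip_uniq EK FK aE (fsubsetP XF _ aX)).
Qed.

End Glue.
End Coding.

(** * Words of standardized interval partitions *)

Section StandardWords.
Local Open Scope nat_scope.

Lemma size_joins w w' : size w = size w' -> size (joins w w') = size w.
Proof. by move=> ww'; rewrite size_map size_zip ww' minnn. Qed.

Lemma nth_joins w w' i : size w = size w' ->
  nth None (joins w w') i = join (nth None w i) (nth None w' i).
Proof.
move=> ww'; case: (ltnP i (size w)) => hi.
  by rewrite (nth_map (None, None)) ?size_zip -?ww' ?minnn // nth_zip.
by rewrite !nth_default // -?ww' // size_joins.
Qed.

Lemma word_letter_joins w w' i : size w = size w' ->
  word_letter (joins w w') i = join (word_letter w i) (word_letter w' i).
Proof. by case: i => [//|i] /nth_joins; apply. Qed.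

Lemma word_letter_encode n (I : IP) : ground I `<=` ivl 1 n ->
  word_letter (encode n I) =1 letter I.
Proof.
move=> In [|i]; first by rewrite letter0.
rewrite /word_letter /=; case: (leqP i.+1 n) => hi; first by rewrite (@nth_encode n I i.+1).
by rewrite nth_default ?size_encode // (letter_gt In hi).
Qed.

Lemma join_false x y : join x y = Some false -> (x == Some false) || (y == Some false).
Proof. by case: x y => [[]|] [[]|]. Qed.

Lemma valid_joins p p' w w' : size w = size w' -> valid p w -> valid p' w' ->
  valid (p || p') (joins w w').
Proof.
elim: w w' p p' => [|x w IH] [|y w'] p p' //= [ww'] /andP[hx vw] /andP[hy vw'].
apply/andP; split; last first.
  have -> : isSome (join x y) = isSome x || isSome y by case: x y {hx hy vw vw'} => [?|] [?|].
  exact: IH.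
apply/implyP => /eqP /join_false /orP[xf|yf].
  by move: hx; rewrite /allowed xf /= => ->.
by move: hy; rewrite /allowed yf /= => ->; rewrite orbT.
Qed.

Lemma glue_eqP (I J s : IP) n : ground I `<=` ivl 1 n -> ground J `<=` ivl 1 n ->
  ground s `<=` ivl 1 n ->
  (glue I J == blocks s) = (joins (encode n I) (encode n J) == encode n s).
Proof.
move=> In Jn sn; set w := joins _ _.
have sz : size (encode n I) = size (encode n J) by rewrite !size_encode.
have szw : size w = n by rewrite size_joins ?size_encode.
have vw : valid false w.
  by have := valid_joins sz (valid_encode n I) (valid_encode n J).
have -> : glue I J = blocks (decode w).
  apply: glue_join => i.
  by rewrite letter_decode // word_letter_joins // !word_letter_encode.
rewrite (inj_eq val_inj) -(inj_eq (@val_inj _ _ _)) /=.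
apply/eqP/eqP => [/val_inj h|h].
  by rewrite -h -{1}szw encode_decode.
by rewrite h decode_encode.
Qed.

(** A standardized ground set leaves no letter [None], so [del] only strips the constructors
    [Some]. *)
Definition word (s : StIP) : seq bool := del (encode (size_st s) s).

Lemma encode_word (s : StIP) : encode (size_st s) s = map Some (word s).
Proof.
rewrite /word /encode; have : all (mem (ground s)) (iota 1 (size_st s)).
  by apply/allP => i; rewrite mem_iota => hi; rewrite inE stip_ground in_ivl; lia.
elim: (iota _ _) => [//|i r IH] /= /andP[ig /IH Er].
rewrite del_cons; have -> : letter s i = Some (~~ linked s i) by rewrite /letter ifT.
by rewrite /=; congr (_ :: _).
Qed.

Lemma size_word s : size (word s) = size_st s.
Proof. by rewrite -(size_map Some) -encode_word size_encode. Qed.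

Lemma word_inj : injective word.
Proof.
move=> s t st; apply: val_inj; apply/(@encode_letterP (size_st s)).
- by rewrite stip_ground.
- by rewrite stip_ground -!size_word st.
- by rewrite encode_word st -encode_word -!size_word st.
Qed.

Lemma good_word s : good (word s).
Proof. exact/valid_good/valid_encode. Qed.

Lemma del_map_Some v : del (map Some v) = v.
Proof. by elim: v => //= b v IH; rewrite del_cons /= IH. Qed.

Lemma valid_map_Some v : good v -> valid false (map Some v).
Proof.
have H u : valid true (map Some u).
  by elim: u => //= b u ->; rewrite /allowed implybT.
by case: v => [|[] v] //= _; rewrite H.
Qed.

Lemma rank_le (A : {fset nat}) x y : x <= y -> rank A x <= rank A y.
Proof.
move=> xy; apply: fsubset_leq_card; apply/fsubsetP => z.
by rewrite !inE /= => /andP[-> /=]; lia.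
Qed.

Lemma letter_std (I : IP) x : x \in ground I ->
  letter (std I) (rank (ground I) x) = letter I x.
Proof.
move=> xg; set A := ground I in xg *.
rewrite /letter ifT -/A; last first.
  have := std_ground I; rewrite /ground /= => ->.
  by rewrite -rank_image; apply/imfsetP; exists x.
rewrite xg; congr (Some (~~ _)).
(* A block containing [x] and a smaller point contains [x.-1] by convexity, so a link after
   standardization was already one before. *)
apply/linkedP/linkedP => [[_ /imfsetP[/= F FI ->] [/imfsetP[/= y yF ry] /imfsetP[/= z zF rz]]]|].
  have inA u : u \in F -> u \in A by move=> uF; apply/in_fcover; exists F.
  have xz : x = z by apply: (rank_inj xg (inA _ zF)).
  rewrite -xz in zF; exists F => //; split=> //.
  have r0 := rank_gt0 xg; have x0 := ground_pos xg.
  have yx : y < x.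
    by rewrite ltnNge; apply/negP => /(rank_le A); rewrite -ry; move: r0; lia.
  by apply: (ip_convex FI yF zF); lia.
move=> [F FI [h1 h2]]; exists (rank A @` F); first by apply/imfsetP; exists F.
split; last by apply/imfsetP; exists x.
apply/imfsetP; exists x.-1 => //=; have x0 := ground_pos xg.
by rewrite -{1}(prednK x0) rankS ?prednK.
Qed.

Lemma del_cat w w' : del (w ++ w') = del w ++ del w'.
Proof. exact: pmap_cat. Qed.

(** Compared prefix by prefix: an absent point adds neither a surviving letter nor rank, and a
    present one adds its own letter by [letter_std]. *)
Lemma word_std n (I : IP) : ground I `<=` ivl 1 n -> word (std I) = del (encode n I).
Proof.
move=> In; set A := ground I.
have H k : del [seq letter I i | i <- iota 1 k]
         = del [seq letter (std I) i | i <- iota 1 (rank A k)].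
  elim: k => [|k IH].
    have -> : rank A 0 = 0; last by [].
    apply/eqP; rewrite cardfs_eq0; apply/eqP/fsetP => y; rewrite !inE /=.
    by apply/negP => /andP[/ground_pos]; lia.
  rewrite -{1}[k.+1]addn1 iotaD map_cat del_cat IH add1n /=.
  case: (boolP (k.+1 \in A)) => kA.
    rewrite rankS // -[(rank A k).+1]addn1 iotaD map_cat del_cat add1n /=.
    by rewrite -(rankS kA) letter_std.
  have -> : letter I k.+1 = None by apply/letter_None.
  rewrite cats0; congr (del (map _ (iota _ _))).
  rewrite /rank; congr (#|` _ |); apply/fsetP => y; rewrite !inE /=.
  by case: (boolP (y \in A)) => //= yA; case: (ltngtP y k.+1) => [|| yk];
    [lia|lia|rewrite -yk yA in kA].
rewrite /word /encode H size_std; congr (del (map _ (iota _ _))).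
rewrite -/A /rank; congr (#|` _ |); apply/fsetP => y; rewrite !inE /=.
by case: (boolP (y \in A)) => //= /(fsubsetP In); rewrite in_ivl; lia.
Qed.

(** Inverse of [word] on good words, where [std] moves no point and serves to land in [StIP]. *)
Definition st_of (v : seq bool) : StIP := std (decode (map Some v)).

Lemma st_ofK v : good v -> word (st_of v) = v.
Proof.
move=> gv; have vv := valid_map_Some gv.
by rewrite (word_std (ground_decode vv)) encode_decode // del_map_Some.
Qed.

Lemma wordK s : st_of (word s) = s.
Proof. by apply: word_inj; rewrite st_ofK // good_word. Qed.

Lemma std_encode n I : ground I `<=` ivl 1 n -> std I = st_of (del (encode n I)).
Proof.
move=> In; apply: word_inj; rewrite st_ofK; first exact: word_std.
exact/valid_good/valid_encode.
Qed.

Lemma word_e : word e_st = [::].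
Proof.
apply/size0nil; rewrite size_word; apply/eqP; rewrite cardfs_eq0.
by apply/eqP/fsetP => x; rewrite inE; apply/negP => /in_fcover[].
Qed.

Lemma word_bullet s t : word (bullet_st s t) = word s ++ word t.
Proof.
rewrite /word size_bullet /encode iotaD map_cat del_cat; set m := size_st s.
have gbound E x : E \in blocks s -> x \in E -> x <= m.
  move=> Es xE; suff : x \in ground s by rewrite stip_ground in_ivl; lia.
  by apply/in_fcover; exists E.
have gE i : (i \in ground (bullet_st s t)) = (1 <= i <= m + size_st t).
  by rewrite bullet_ground in_ivl.
congr (del _ ++ del _).
  apply/eq_in_map => i; rewrite mem_iota => hi.
  rewrite /letter -!/(ground _) gE stip_ground in_ivl -/m !ifT; try by lia.
  congr (Some (~~ _)); apply/linkedP/linkedP => -[E].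
    rewrite in_fsetU => /orP[Es|/imfsetP[F /= Ft ->]]; first by exists E.
    by move=> [_ /imfsetP[y /= /(ip_pos Ft)]]; lia.
  by move=> Es h; exists E => //; rewrite in_fsetU Es.
rewrite addnC iotaDl -map_comp; apply/eq_in_map => i; rewrite mem_iota => hi /=.
rewrite /letter -!/(ground _) gE stip_ground in_ivl !ifT; try by lia.
congr (Some (~~ _)); apply/linkedP/linkedP => -[E].
  rewrite in_fsetU => /orP[Es [_ /(gbound _ _ Es)]|/imfsetP[F /= Ft ->]]; first by lia.
  move=> [/imfsetP[y /= yF h1] /imfsetP[z /= zF h2]].
  have zi : z = i by lia.
  have yi : y = i.-1 by have := ip_pos Ft yF; lia.
  by exists F => //; rewrite -yi -zi.
move=> Et [h1 h2]; exists (shift m E).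
  by rewrite in_fsetU; apply/orP; right; apply/imfsetP; exists E.
by split; apply/imfsetP; [exists i.-1|exists i] => //=; lia.
Qed.

Lemma bullet_st_of v w : good v -> good w ->
  bullet_st (st_of v) (st_of w) = st_of (v ++ w).
Proof.
move=> gv gw; apply: word_inj; rewrite word_bullet !st_ofK //.
by case: v gv.
Qed.

Lemma st_of_eq_e v : good v -> (st_of v == e_st) = (v == [::]).
Proof. by move=> gv; rewrite -(inj_eq word_inj) st_ofK // word_e. Qed.

End StandardWords.

(** * The bialgebras of interval partitions *)

Section HInt.

Local Notation H_int := {malg rat[StIP]}.
Local Notation H_int2 := {malg rat[(StIP * StIP)%type]}.

Definition sub_ips (n : nat) : {fset IP} :=
  [fset I in pmap insub (fpowerset (fpowerset (ivl 1 n)))].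

Lemma mem_sub_ips n (I : IP) : (I \in sub_ips n) = (ground I `<=` ivl 1 n).
Proof.
rewrite !inE /= mem_pmap_sub fpowersetE; apply/fsubsetP/fsubsetP => h.
  move=> x /in_fcover[E /h]; rewrite fpowersetE => /fsubsetP; exact.
move=> E EI; rewrite fpowersetE; apply/fsubsetP => x xE; apply: h.
by apply/in_fcover; exists E.
Qed.

(** Every partition lies over exactly one [A], its ground set. *)
Lemma sum_IP_on (V : nmodType) n (P : pred IP) (G : IP -> V) :
  \sum_(A <- fpowerset (ivl 1 n)) \sum_(I <- IP_on A | P I) G I =
  \sum_(I <- sub_ips n | P I) G I.
Proof.
transitivity (\sum_(A <- fpowerset (ivl 1 n)) \sum_(I <- sub_ips n | P I)
    if ground I == A then G I else 0).
  rewrite big_seq [RHS]big_seq; apply: eq_bigr => A; rewrite fpowersetE => An.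
  rewrite -big_mkcondr /= -[LHS]big_filter -[RHS]big_filter; apply: perm_big.
  apply: uniq_perm; rewrite ?filter_uniq ?fset_uniq // => I.
  rewrite !mem_filter mem_IP_on mem_sub_ips -andbA; congr (_ && _).
  by case: eqP => // ->; rewrite An.
rewrite exchange_big /= big_seq_cond [RHS]big_seq_cond; apply: eq_bigr => I.
rewrite mem_sub_ips => /andP[In _]; rewrite (big_fsetD1 (ground I)) ?fpowersetE //=.
rewrite eqxx big1_fset ?addr0 // => A; rewrite in_fsetD1 => /andP[nA _] _.
by rewrite eq_sym (negbTE nA).
Qed.

(** The condition on [A] and [A'] disappears because [glue_ground] makes it a consequence of the
    gluing condition. *)
Lemma comul_spade_st_glue s : comul_spade_st s =
  \sum_(I <- sub_ips (size_st s))
    \sum_(I' <- sub_ips (size_st s) | glue I I' == blocks s) << (std I, std I') >>.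
Proof.
rewrite /comul_spade_st -[RHS](@sum_IP_on _ _ predT) /= -stip_ground.
apply: eq_bigr => A _; rewrite exchange_big /= big_seq [RHS]big_seq.
apply: eq_bigr => I; rewrite mem_IP_on => /eqP gI.
rewrite stip_ground -sum_IP_on -stip_ground [LHS]big_mkcond /=; apply: eq_bigr => A' _.
case: ifP => [_|nA]; first by apply: eq_bigr => I' _; rewrite tensU.
rewrite big_seq_cond big1 // => I'; rewrite mem_IP_on => /andP[/eqP gI' /eqP gl].
by have := glue_ground I I'; rewrite gl -/(ground s) gI gI' => h; rewrite h eqxx in nA.
Qed.

(** Decoding both components is a bijection from the splits of the word of [s] to the pairs gluing
    to [s], and standardizing a decoded word deletes its letters [None]. *)
Lemma comul_spade_stE s : comul_spade_st s =
  split_sum false false (word s) (fun v v' => << (st_of v, st_of v') >>).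
Proof.
rewrite comul_spade_st_glue; set n := size_st s.
have sn : ground s `<=` ivl 1 n by rewrite stip_ground.
have memP w : w \in splits false false (word s) ->
    [/\ valid false w.1, valid false w.2, size w.1 = n, size w.2 = n
      & joins w.1 w.2 = map Some (word s)].
  rewrite mem_splits => /and4P[v1 v2 /eqP sz /eqP wE].
  have := size_joins sz; rewrite wE size_map size_word => n1.
  by split; rewrite // -?sz -n1.
pose ips : seq IP := sub_ips n.
transitivity (\sum_(p <- filter (fun p : IP * IP => glue p.1 p.2 == blocks s)
                              (allpairs pair ips ips))
   (<< (std p.1, std p.2) >> : H_int2)).
  rewrite big_filter [RHS]big_mkcond [RHS]big_allpairs_dep /=; apply: eq_bigr => I _.
  by rewrite -big_mkcond.
rewrite (perm_big [seq (decode w.1, decode w.2) | w <- splits false false (word s)]).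
  rewrite big_map big_seq /split_sum [RHS]big_seq; apply: eq_bigr => w.
  move=> /memP[v1 v2 n1 n2 _] /=.
  rewrite (std_encode (ground_decode v1)) (std_encode (ground_decode v2)).
  by rewrite !encode_decode.
apply: uniq_perm.
- rewrite filter_uniq //; apply: allpairs_uniq; rewrite ?fset_uniq //.
  by move=> [? ?] [? ?].
- rewrite map_inj_in_uniq ?splits_uniq // => -[w1 w2] [w1' w2'].
  move=> /memP[/= v1 v2 n1 n2 _] /memP[/= v1' v2' n1' n2' _] [e1 e2].
  by rewrite -(encode_decode v1) -(encode_decode v2) e1 e2 n1 n2 -{1}n1' -n2' !encode_decode.
move=> [I I']; rewrite mem_filter /=; apply/andP/mapP.
  move=> [gl /allpairsP[[J J'] /= [hI hI' [E1 E2]]]].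
  rewrite -{}E1 -{}E2 !mem_sub_ips in hI hI'.
  exists (encode n I, encode n I'); last by rewrite /= !decode_encode.
  rewrite mem_splits /= !valid_encode !size_encode eqxx /=.
  by rewrite -encode_word -glue_eqP.
move=> [w /memP[v1 v2 n1 n2 wE] [-> ->]].
have g1 := ground_decode v1; have g2 := ground_decode v2; rewrite n1 in g1; rewrite n2 in g2.
split; last first.
  by apply/allpairsP; exists (decode w.1, decode w.2); rewrite /= !mem_sub_ips.
by rewrite (glue_eqP g1 g2 sn) -{1}n1 -{1}n2 !encode_decode // wE encode_word.
Qed.

(** Only good words arise in a splitting from states [false]; on them [st_of] inverts [word] and is
    multiplicative. *)
Lemma eq_split_sum_good (V : nmodType) s (F F' : seq bool -> seq bool -> V) :
  (forall v v', good v -> good v' -> F v v' = F' v v') ->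
  split_sum false false s F = split_sum false false s F'.
Proof.
move=> FF'; rewrite /split_sum big_seq [RHS]big_seq; apply: eq_bigr => w.
by rewrite mem_splits => /and4P[/valid_good v1 /valid_good v2 _ _]; apply: FF'.
Qed.

Lemma linear_split_sum (R : fieldType) (U V : lmodType R) (f : U -> V) p p' s F :
  linear f ->
  f (split_sum p p' s F) = split_sum p p' s (fun v v' => f (F v v')).
Proof. by move=> fl; rewrite /split_sum (linearP_sum fl). Qed.

Lemma bulletU s t : bullet << s >> << t >> = << bullet_st s t >>.
Proof. exact: bilin_extU. Qed.

Lemma comul_spadeU s : comul_spade << s >> =
  split_sum false false (word s) (fun v v' => << (st_of v, st_of v') >>).
Proof. by rewrite /comul_spade lin_extU comul_spade_stE. Qed.

Lemma counit_intE x : counit_int x = x@_e_st.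
Proof.
move: x; apply: (@linear_ext _ _ rat^o) => [c x y|c x y|s] /=.
- by rewrite /counit_int lin_extP.
- by rewrite mcoeffP.
by rewrite /counit_int lin_extU mcoeffU.
Qed.

Lemma unit_int1 : unit_int 1 = << e_st >>.
Proof. exact: scale1r. Qed.

Lemma bullet_algebra : is_algebra bullet unit_int.
Proof.
split.
- by move=> y; exact: bilin_extPl.
- by move=> x; exact: bilin_extPr.
- by move=> c x y; rewrite /unit_int scalerDl scalerA.
- have bl y : linear (bullet^~ y) by exact: bilin_extPl.
  have br x : linear (bullet x) by exact: bilin_extPr.
  move=> x y z.
  move: x; apply: linear_ext => [c x w|c x w|a] /=; [by rewrite bl|by rewrite !bl|].
  move: y; apply: linear_ext => [c x w|c x w|b] /=; [by rewrite bl br|by rewrite br bl|].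
  move: z; apply: linear_ext => [c x w|c x w|d] /=; [by rewrite !br|by rewrite br|].
  rewrite !bulletU; congr << _ >>; apply: word_inj.
  by rewrite !word_bullet catA.
- rewrite unit_int1; apply: linear_ext => [||s] //; first exact: bilin_extPr.
  by rewrite bulletU; congr << _ >>; apply: word_inj; rewrite word_bullet word_e.
- rewrite unit_int1; apply: linear_ext => [||s] //; first exact: bilin_extPl.
  by rewrite bulletU; congr << _ >>; apply: word_inj; rewrite word_bullet word_e cats0.
Qed.

Lemma comul_spade_coalgebra : is_coalgebra comul_spade counit_int.
Proof.
have Dl : linear comul_spade by exact: lin_extP.
split=> //.
- by move=> c x y; rewrite !counit_intE mcoeffD mcoeffZ.
- apply: linear_ext => [c x y|c x y|s] /=.
  + by rewrite Dl tens_mapP tens_assocP.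
  + by rewrite Dl tens_mapP.
  rewrite comul_spadeU !(linear_split_sum _ _ _ _ (@tens_mapP _ _ _ _ _ _ _)).
  rewrite (linear_split_sum _ _ _ _ (@tens_assocP _ _ _ _)).
  pose F v1 v2 v3 : {malg rat[(StIP * (StIP * StIP))%type]} :=
    << (st_of v1, (st_of v2, st_of v3)) >>.
  transitivity (split_sum false false (word s) (fun v v3 =>
      split_sum false false v (fun v1 v2 => F v1 v2 v3))).
    apply: eq_split_sum_good => v v3 gv _.
    rewrite tens_mapU comul_spadeU st_ofK //.
    rewrite (linear_split_sum _ _ _ _ (@tensPl _ _ _ _)).
    rewrite (linear_split_sum _ _ _ _ (@tens_assocP _ _ _ _)).
    by apply: eq_split_sum => v1 v2; rewrite tensU tens_assocU.
  rewrite split_sum_coassoc; apply: eq_split_sum_good => v1 v _ gv.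
  rewrite tens_mapU comul_spadeU st_ofK //.
  rewrite (linear_split_sum _ _ _ _ (@tensPr _ _ _ _)).
  by apply: eq_split_sum => v2 v3; rewrite tensU.
- apply: linear_ext => [c x y|//|s] /=; first by rewrite Dl tens_liftP.
  rewrite comul_spadeU (linear_split_sum _ _ _ _ (@tens_liftP _ _ _ _ _)).
  rewrite -{2}[s]wordK -(@split_sum_counit_l _ false false _ (fun v => << st_of v >> : H_int)) ?good_word //.
  apply: eq_split_sum_good => v v' gv gv'.
  by rewrite tens_liftU counit_intE mcoeffU st_of_eq_e //; case: eqP; rewrite ?scale1r ?scale0r.
- apply: linear_ext => [c x y|//|s] /=; first by rewrite Dl tens_liftP.
  rewrite comul_spadeU (linear_split_sum _ _ _ _ (@tens_liftP _ _ _ _ _)).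
  rewrite -{2}[s]wordK -(split_sum_counit_r (fun v => << st_of v >> : H_int)) ?good_word //.
  apply: eq_split_sum_good => v v' gv gv'.
  by rewrite tens_liftU counit_intE mcoeffU st_of_eq_e //; case: eqP; rewrite ?scale1r ?scale0r.
Qed.

Lemma bullet_spade_bialgebra : is_bialgebra bullet comul_spade unit_int counit_int.
Proof.
have Dl : linear comul_spade by exact: lin_extP.
have bl y : linear (bullet^~ y) by exact: bilin_extPl.
have br x : linear (bullet x) by exact: bilin_extPr.
have counitl : linear (counit_int : H_int -> rat^o) by exact: lin_extP.
split.
- exact: bullet_algebra.
- exact: comul_spade_coalgebra.
- move=> x y.
  move: x; apply: linear_ext => [c x w|c x w|s] /=.
  + by rewrite bl Dl.
  + by rewrite Dl tens_mulPl.
  move: y; apply: linear_ext => [c x w|c x w|t] /=.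
  + by rewrite br Dl.
  + by rewrite Dl tens_mulPr.
  rewrite bulletU !comul_spadeU word_bullet split_sum_cat ?good_word //.
  rewrite (linear_split_sum _ _ _ _ (@tens_mulPl _ _ _ _)).
  apply: eq_split_sum_good => v v' gv gv'.
  rewrite (linear_split_sum _ _ _ _ (@tens_mulPr _ _ _ _)).
  apply: eq_split_sum_good => w w' gw gw'.
  by rewrite tens_mulU !bulletU tensU !bullet_st_of.
- rewrite unit_int1 comul_spadeU word_e split_sum0 tensU.
  by rewrite -word_e !wordK.
- move=> x y.
  move: x; apply: (@linear_ext _ _ rat^o) => [c x w|c x w|s] /=.
  + by rewrite bl counitl.
  + by rewrite counitl mulrDl -mulrA.
  move: y; apply: (@linear_ext _ _ rat^o) => [c x w|c x w|t] /=.
  + by rewrite br counitl.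
  + by rewrite counitl mulrDr mulrCA.
  rewrite bulletU !counit_intE !mcoeffU -!(inj_eq word_inj) word_bullet word_e.
  by case: (word s) => [|? ?]; rewrite ?mulr1n ?mulr0n ?mul1r ?mul0r.
- by rewrite unit_int1 counit_intE mcoeffUU.
Qed.

Lemma spade_bullet_bialgebra : is_bialgebra spade comul_bullet unit_int counit_int.
Proof.
apply: (@dual_bialgebra _ _ bullet _ comul_spade _ _ _ e_st).
- exact: bullet_spade_bialgebra.
- by [].
- exact: counit_intE.
- by move=> y; exact: bilin_extPl.
- by move=> x; exact: bilin_extPr.
- exact: lin_extP.
- by move=> s t g; rewrite /spade bilin_extU spade_stE /comul_spade lin_extU.
- by move=> g s t; rewrite /comul_bullet lin_extU comul_bullet_stE bulletU mcoeffU.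
Qed.

(** * Degree estimates, antipode and the two filtrations *)

Lemma msupp_comul_bullet s p :
  p \in msupp (comul_bullet << s >>) -> bullet_st p.1 p.2 = s.
Proof.
case: p => a b; rewrite -mcoeff_neq0 /comul_bullet lin_extU comul_bullet_stE.
by case: (bullet_st a b =P s) => //=; rewrite eqxx.
Qed.

Lemma size_st_eq0 s : size_st s = 0%N <-> s = e_st.
Proof.
split=> [|->]; last by rewrite -size_word word_e.
by rewrite -size_word => /size0nil h; apply: word_inj; rewrite h word_e.
Qed.

Lemma spade_hopf : is_hopf_algebra spade comul_bullet unit_int counit_int.
Proof.
split; first exact: spade_bullet_bialgebra.
apply: (@connected_antipode _ _ _ _ _ _ e_st size_st).
- exact: spade_bullet_bialgebra.
- by [].
- exact: counit_intE.
- by move=> s /size_st_eq0.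
- by move=> s p /msupp_comul_bullet <-; rewrite size_bullet.
Qed.

(** A nonzero coefficient requires at least one gluing, from which the degree bounds are then
    read. *)
Lemma msupp_spade s t g : g \in msupp (spade << s >> << t >>) ->
  exists I I', [/\ glue I I' = blocks g, std I = s & std I' = t].
Proof.
rewrite -mcoeff_neq0 /spade bilin_extU spade_stE comul_spade_st_glue.
rewrite raddf_sum /= => h.
case: (boolP (has (fun I => has (fun I' => [&& glue I I' == blocks g, std I == s
   & std I' == t]) (sub_ips (size_st g))) (sub_ips (size_st g)))).
  by move=> /hasP[I _ /hasP[I' _ /and3P[/eqP ? /eqP ? /eqP ?]]]; exists I, I'.
move=> /hasPn no; case/eqP: h; rewrite big1_seq // => I /andP[_ /no /hasPn no'].
rewrite raddf_sum big1_seq //= => I' /andP[gl /no']; rewrite gl /= => /negbTE h.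
by rewrite mcoeffU xpair_eqE h.
Qed.

Lemma size_spade s t g : g \in msupp (spade << s >> << t >>) ->
  (size_st g <= size_st s + size_st t)%N.
Proof.
case/msupp_spade => I [I' [gl <- <-]]; rewrite !size_std /size_st /ground -gl.
by rewrite glue_ground (leq_card_fsetU _ _).1.
Qed.

Lemma nblocks_std (I : IP) : nblocks (std I) = #|` blocks I|.
Proof.
rewrite /nblocks /= card_in_imfset // => E F EI FI EF.
have [a [b [ab Eab]]] := ip_block_ivl EI.
have aE : a \in E by rewrite Eab in_ivl; lia.
have : rank (ground I) a \in rank (ground I) @` F.
  by rewrite -[X in _ \in X]EF; apply/imfsetP; exists a.
move=> /imfsetP[y /= yF /rank_inj ay].
apply: (ip_uniq EI FI aE); rewrite ay //.
  by apply/in_fcover; exists E.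
by apply/in_fcover; exists F.
Qed.

(** Glued blocks are indexed, possibly with repetitions, by the blocks of the two partitions. *)
Lemma nblocks_spade s t g : g \in msupp (spade << s >> << t >>) ->
  (nblocks g <= nblocks s + nblocks t)%N.
Proof.
case/msupp_spade => I [I' [gl <- <-]]; rewrite !nblocks_std /nblocks -gl.
apply: leq_trans (leq_card_fsetU _ _).1.
rewrite /glue; apply: leq_trans (leq_imfset_card _ _ _) _ => /=.
by rewrite -cardE -cardfE.
Qed.

(** Shifting is injective, and a shifted block contains a point above [m], so it is no block of
    [s]. *)
Lemma nblocks_bullet s t : nblocks (bullet_st s t) = (nblocks s + nblocks t)%N.
Proof.
rewrite /nblocks /= /bullet_blocks; set m := size_st s.
have sub E F x : shift m E = shift m F -> x \in E -> x \in F.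
  move=> EF xE; have : (m + x)%N \in shift m F by rewrite -EF; apply/imfsetP; exists x.
  by move=> /imfsetP[y /= yF /addnI ->].
have shift_inj : injective (shift m).
  by move=> E F EF; apply/fsetP => x; apply/idP/idP; apply: sub.
rewrite cardfsU (_ : _ `&` _ = fset0) ?cardfs0 ?subn0.
  by rewrite card_imfset.
apply/eqP; rewrite -fsubset0; apply/fsubsetP => E; rewrite in_fsetI => /andP[Es].
move=> /imfsetP[F /= Ft EF]; have [a [b [ab Fab]]] := ip_block_ivl Ft.
have aF : a \in F by rewrite Fab in_ivl; lia.
have : (m + a)%N \in ground s.
  by apply/in_fcover; exists E => //; rewrite EF; apply/imfsetP; exists a.
by rewrite stip_ground in_ivl -/m; lia.
Qed.

Lemma nblocks_eq0 s : nblocks s = 0%N <-> s = e_st.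
Proof.
split=> [/eqP|->]; last by rewrite /nblocks cardfs0.
by rewrite cardfs_eq0 => /eqP s0; apply/val_inj/val_inj.
Qed.

(** Size and number of blocks enter only through these four properties, so one argument serves both
    filtrations. *)
Lemma connected_filtered_of_deg (deg : StIP -> nat) (V : nat -> H_int -> Prop) :
  (forall k y, V k y <-> basis_span (fun s => deg s == k) y) ->
  (forall s, deg s = 0%N <-> s = e_st) ->
  (forall s t, deg (bullet_st s t) = (deg s + deg t)%N) ->
  (forall s t g, g \in msupp (spade << s >> << t >>) -> (deg g <= deg s + deg t)%N) ->
  is_connected_filtered_hopf spade comul_bullet unit_int counit_int
    (grading_filtration V).
Proof.
move=> VE deg0 degB degS.
have FE n x := @grading_filtrationP _ _ deg n x V VE.
split; first exact: spade_hopf; last exact: one_dimensional_deg0 deg0.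
apply: (filtered_of_deg FE).
- by move=> y; exact: bilin_extPl.
- by move=> x; exact: bilin_extPr.
- exact: lin_extP.
- exact: degS.
- by move=> s p /msupp_comul_bullet <-; rewrite degB.
Qed.

End HInt.

Theorem theorem3p30 :
  is_bialgebra bullet comul_spade unit_int counit_int /\
  is_connected_filtered_hopf spade comul_bullet unit_int counit_int
    (grading_filtration size_grading) /\
  is_connected_filtered_hopf spade comul_bullet unit_int counit_int
    (grading_filtration block_grading).
Proof.
split; first exact: bullet_spade_bialgebra.
split.
  apply: (@connected_filtered_of_deg size_st).
  - move=> k y; split=> h s /h /=; by rewrite mem_StIP_n.
  - exact: size_st_eq0.
  - exact: size_bullet.
  - exact: size_spade.
apply: (@connected_filtered_of_deg nblocks) => //.
- exact: nblocks_eq0.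
- exact: nblocks_bullet.
- exact: nblocks_spade.
Qed.
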